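(* There exists a reduced network system $\hat{\mathbf{\Sigma}}$ (of the form described in the context) such that $\|\mathbf{\Sigma}_e\|_{\mathcal{H}_\infty} < \gamma$ if and only if there exist matrices $\hat{X}\in\mathbb{S}^{m}_{++}$, $\hat{W}\in\mathbb{D}^{|\hat{\mathcal{E}}|}_{++}$, $\hat{E}\in\mathbb{D}^{r}_{++}$, and a sufficiently small $\hat{\theta}\in\mathbb{R}_{++}$ such that $$\Phi_\infty(\hat{X},\hat{\gamma},\hat{W},\hat{E}) = \psi_\infty(\hat{X},\hat{\gamma}) + \phi_\infty(\hat{W},\hat{E}) \prec \mathbf{0},$$ where $\hat{\gamma}=\hat{\theta}\gamma$ and $$\psi_\infty(\hat{X},\hat{\gamma})=\begin{bmatrix}\bar{A}_{en}^T\hat{X}+\hat{X}\bar{A}_{en} & \hat{X}\bar{B}_{en} & \hat{\theta}\bar{C}_{en}^T & \hat{X}J\\ \bar{B}_{en}^T\hat{X} & -\hat{\gamma}I_p & \mathbf{0} & \mathbf{0}\\ \hat{\theta}\bar{C}_{en} & \mathbf{0} & -\hat{\gamma}I_q & \mathbf{0}\\ J^T\hat{X} & \mathbf{0} & \mathbf{0} & \mathbf{0}\end{bmatrix},$$ $$\phi_\infty(\hat{W},\hat{E})=\begin{bmatrix}-\bar{A}_{er}^T\bar{A}_{er} & -\bar{A}_{er}^T\bar{B}_{er} & \hat{\theta}\bar{C}_{er}^T & \bar{A}_{er}^T\\ -\bar{B}_{er}^T\bar{A}_{er} & -\bar{B}_{er}^T\bar{B}_{er} & \mathbf{0} & \bar{B}_{er}^T\\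 \hat{\theta}\bar{C}_{er} & \mathbf{0} & \mathbf{0} & \mathbf{0}\\ \bar{A}_{er} & \bar{B}_{er} & \mathbf{0} & -I_m\end{bmatrix}.$$
   Context: Original consensus network system $\mathbf{\Sigma}$: $E\dot{x}=-Lx+Fu$, $y=Hx$, with $x\in\mathbb{R}^n$, $u\in\mathbb{R}^p$, $y\in\mathbb{R}^q$, over a simple undirected weighted connected graph with incidence matrix $D\in\mathbb{R}^{n\times|\mathcal{E}|}$, edge-weight matrix $W\in\mathbb{D}^{|\mathcal{E}|}_{++}$ (diagonal positive definite), nodal time-scale matrix $E\in\mathbb{D}^n_{++}$, Laplacian $L=DWD^T$. Given a clustering matrix $\Pi\in\{0,1\}^{n\times r}$ ($[\Pi]_{ij}=1$ iff node $i$ is in cluster $j$, $\Pi\mathbf{1}_r=\mathbf{1}_n$), the reduced system $\hat{\mathbf{\Sigma}}$ is $\hat{E}\dot{\hat{x}}=-\hat{L}\hat{x}+\beta\hat{F}u$, $\hat{y}=\alpha\hat{H}\hat{x}$ with $\hat{L}=\hat{D}\hat{W}\hat{D}^T$, $\hat{D}$ obtained by deleting duplicate and zero columns of $\Pi^TD$, $\hat{F}=\Pi^TF$, $\hat{H}=H\Pi$, $\hat{W}\in\mathbb{D}^{|\hat{\mathcal{E}}|}_{++}$, $\hat{E}\in\mathbb{D}^r_{++}$, and $\alpha=1$, $\beta=\mathbf{tr}(\hat{E})/\mathbf{tr}(E)$ (which makes the error system BIBO stable). $\mathbf{\Sigma}_e=\mathbf{\Sigma}-\hat{\mathbf{\Sigma}}$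 is the error system. Let $S_n=\begin{bmatrix}-I_{n-1}\\ \mathbf{1}_{n-1}^T\end{bmatrix}$, $S_n^L=(S_n^TE^{-1}S_n)^{-1}S_n^TE^{-1}$, and $S_r$, $S_r^L$ defined analogously with $r$ and $\hat{E}$; let $m=n+r-2$. Define $\bar{A}_{en}=\begin{bmatrix}-S_n^LLE^{-1}S_n & \mathbf{0}\\ \mathbf{0}&\mathbf{0}\end{bmatrix}$, $\bar{B}_{en}=\begin{bmatrix}S_n^LF\\ \mathbf{0}\end{bmatrix}$, $\bar{A}_{er}=\begin{bmatrix}\mathbf{0} & -S_r^L\hat{L}\hat{E}^{-1}S_r\\ \mathbf{0}&\mathbf{0}\end{bmatrix}$, $\bar{B}_{er}=\begin{bmatrix}\beta S_r^L\hat{F}\\ \mathbf{0}\end{bmatrix}$, $\bar{C}_{en}=\begin{bmatrix}HE^{-1}S_n & \mathbf{0}\end{bmatrix}$, $\bar{C}_{er}=\begin{bmatrix}\mathbf{0} & -\alpha\hat{H}\hat{E}^{-1}S_r\end{bmatrix}$, $J=\begin{bmatrix}\mathbf{0}&\mathbf{0}\\ I_{r-1}&\mathbf{0}\end{bmatrix}$, all in $\mathbb{R}^{m\times m}$, $\mathbb{R}^{m\times p}$ or $\mathbb{R}^{q\times m}$ as appropriate, so that the error system (after removing the two cancelling zero modes) has realization $(\bar{A}_{en}+J\bar{A}_{er},\ \bar{B}_{en}+J\bar{B}_{er},\ \bar{C}_{en}+\bar{C}_{er})$. *)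

(* Defs.v *)
From HB Require Import structures.
From mathcomp Require Import all_boot all_order all_algebra.
From mathcomp Require Import complex.
From mathcomp Require Import boolp classical_sets reals constructive_ereal ereal.
Set Implicit Arguments. Unset Strict Implicit. Unset Printing Implicit Defensive.
Import Order.TTheory GRing.Theory Num.Theory.
Local Open Scope ring_scope.

Section Defs.
Variable R : realType.

Definition posdiag k (M : 'M[R]_k) : Prop :=
  is_diag_mx M /\ forall i, 0 < M i i.

Definition posdef k (M : 'M[R]_k) : Prop :=
  M^T = M /\ forall v : 'cV[R]_k, v != 0 -> 0 < (v^T *m M *m v) 0 0.

Definition negdef k (M : 'M[R]_k) : Prop :=
  M^T = M /\ forall v : 'cV[R]_k, v != 0 -> (v^T *m M *m v) 0 0 < 0.

Definition is_incidence n mE (D : 'M[R]_(n, mE)) : Prop :=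
  forall e, exists i j, i != j /\ D i e = 1 /\ D j e = -1 /\
     (forall k, k != i -> k != j -> D k e = 0).

Definition simple_incidence n mE (D : 'M[R]_(n, mE)) : Prop :=
  forall e e', e != e' -> col e D != col e' D /\ col e D != - col e' D.

Definition adjacent n mE (D : 'M[R]_(n, mE)) : rel 'I_n :=
  fun i j => [exists e, [&& i != j, D i e != 0 & D j e != 0]].

Definition connected_incidence n mE (D : 'M[R]_(n, mE)) : Prop :=
  forall i j, connect (adjacent D) i j.

Definition clustering n r (Pi : 'M[R]_(n, r)) : Prop :=
  (forall i j, Pi i j = 0 \/ Pi i j = 1) /\
  Pi *m (const_mx 1 : 'cV[R]_r) = (const_mx 1 : 'cV[R]_n) /\
  (forall j, exists i, Pi i j = 1).

(* Dh is obtained from Pi^T D by deleting duplicate and zero columns: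
   its columns are nonzero, pairwise distinct, and are exactly the nonzero
   columns of Pi^T D (in some order). *)
Definition reduced_incidence n r mE mEh (Pi : 'M[R]_(n, r))
    (D : 'M[R]_(n, mE)) (Dh : 'M[R]_(r, mEh)) : Prop :=
  let PD := Pi^T *m D in
  (forall e', col e' Dh != 0) /\
  (forall e1 e2, col e1 Dh = col e2 Dh -> e1 = e2) /\
  (forall e', exists e, col e' Dh = col e PD) /\
  (forall e, col e PD != 0 -> exists e', col e' Dh = col e PD).

(* S_n = [ -I_{n-1} ; 1^T_{n-1} ] *)
Definition Smat n : 'M[R]_(n, n.-1) :=
  \matrix_(i < n, j < n.-1)
     (if (i : nat) == j then -1 else if (i : nat) == n.-1 then 1 else 0).

Definition SLmat n (E : 'M[R]_n) : 'M[R]_(n.-1, n) :=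
  invmx ((Smat n)^T *m invmx E *m Smat n) *m (Smat n)^T *m invmx E.

Definition Lap mE n (D : 'M[R]_(n, mE)) (W : 'M[R]_mE) : 'M[R]_n :=
  D *m W *m D^T.

Section ErrorSystem.
Variables (n r p q mE mEh : nat).
Variables (E : 'M[R]_n) (D : 'M[R]_(n, mE)) (W : 'M[R]_mE)
          (F : 'M[R]_(n, p)) (H : 'M[R]_(q, n)) (Pi : 'M[R]_(n, r))
          (Dh : 'M[R]_(r, mEh)) (Wh : 'M[R]_mEh) (Eh : 'M[R]_r).

Local Notation m := (n.-1 + r.-1)%N.

Definition Lmat := Lap D W.
Definition Lhat := Lap Dh Wh.
Definition Fhat : 'M[R]_(r, p) := Pi^T *m F.
Definition Hhat : 'M[R]_(q, r) := H *m Pi.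
Definition alpha : R := 1.
Definition beta : R := \tr Eh / \tr E.

Definition Aen : 'M[R]_m :=
  block_mx (- (SLmat E *m Lmat *m invmx E *m Smat n)) 0 0 0.
Definition Ben : 'M[R]_(m, p) := col_mx (SLmat E *m F) 0.
(* block rows of Aer, Ber are partitioned as (r-1, n-1) *)
Definition Aer : 'M[R]_m :=
  castmx (addnC r.-1 n.-1, erefl m)
    (block_mx (0 : 'M[R]_(r.-1, n.-1))
              (- (SLmat Eh *m Lhat *m invmx Eh *m Smat r)) 0 0).
Definition Ber : 'M[R]_(m, p) :=
  castmx (addnC r.-1 n.-1, erefl p)
    (col_mx (beta *: (SLmat Eh *m Fhat)) (0 : 'M[R]_(n.-1, p))).
Definition Cen : 'M[R]_(q, m) := row_mx (H *m invmx E *m Smat n) 0.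
Definition Cer : 'M[R]_(q, m) :=
  row_mx 0 (- (alpha *: (Hhat *m invmx Eh *m Smat r))).
Definition Jmat : 'M[R]_m :=
  castmx (erefl m, addnC r.-1 n.-1)
    (block_mx (0 : 'M[R]_(n.-1, r.-1)) (0 : 'M[R]_(n.-1, n.-1))
              (1%:M : 'M[R]_(r.-1)) (0 : 'M[R]_(r.-1, n.-1))).

Definition Ae : 'M[R]_m := Aen + Jmat *m Aer.
Definition Be : 'M[R]_(m, p) := Ben + Jmat *m Ber.
Definition Ce : 'M[R]_(q, m) := Cen + Cer.

Definition blk4 a b c d
  (M11 : 'M[R]_(a, a)) (M12 : 'M[R]_(a, b)) (M13 : 'M[R]_(a, c)) (M14 : 'M[R]_(a, d))
  (M21 : 'M[R]_(b, a)) (M22 : 'M[R]_(b, b)) (M23 : 'M[R]_(b, c)) (M24 : 'M[R]_(b, d))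
  (M31 : 'M[R]_(c, a)) (M32 : 'M[R]_(c, b)) (M33 : 'M[R]_(c, c)) (M34 : 'M[R]_(c, d))
  (M41 : 'M[R]_(d, a)) (M42 : 'M[R]_(d, b)) (M43 : 'M[R]_(d, c)) (M44 : 'M[R]_(d, d))
  : 'M[R]_((a + b) + (c + d)) :=
  block_mx (block_mx M11 M12 M21 M22) (block_mx M13 M14 M23 M24)
           (block_mx M31 M32 M41 M42) (block_mx M33 M34 M43 M44).

Definition psi_inf (X : 'M[R]_m) (theta gammah : R) :=
  blk4 (Aen^T *m X + X *m Aen) (X *m Ben) (theta *: Cen^T) (X *m Jmat)
       (Ben^T *m X) (- (gammah *: 1%:M)) 0 0
       (theta *: Cen) 0 (- (gammah *: 1%:M)) 0
       (Jmat^T *m X) 0 0 0.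

Definition phi_inf (theta : R) :=
  blk4 (- (Aer^T *m Aer)) (- (Aer^T *m Ber)) (theta *: Cer^T) (Aer^T)
       (- (Ber^T *m Aer)) (- (Ber^T *m Ber)) 0 (Ber^T)
       (theta *: Cer) 0 0 0
       Aer Ber 0 (- 1%:M).

Definition Phi_inf (X : 'M[R]_m) (theta gamma : R) :=
  psi_inf X theta (theta * gamma) + phi_inf theta.

End ErrorSystem.

Local Open Scope complex_scope.

Definition cmx a b (M : 'M[R]_(a, b)) : 'M[R[i]]_(a, b) :=
  map_mx (fun x => x%:C) M.

Definition cvnorm k (u : 'cV[R[i]]_k) : R :=
  Num.sqrt (\sum_(j < k) ((complex.Re (u j 0)) ^+ 2 + (complex.Im (u j 0)) ^+ 2)).

Definition sigma_max a b (M : 'M[R[i]]_(a, b)) : R :=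
  sup [set cvnorm (M *m u) | u in [set u : 'cV[R[i]]_b | cvnorm u <= 1]].

Definition hurwitz k (A : 'M[R]_k) : Prop :=
  forall lam : R[i], eigenvalue (cmx A) lam -> complex.Re lam < 0.

Definition tfun k p q (A : 'M[R]_k) (B : 'M[R]_(k, p)) (C : 'M[R]_(q, k))
  (s : R[i]) : 'M[R[i]]_(q, p) :=
  cmx C *m invmx (s%:M - cmx A) *m cmx B.

Definition Hinf_norm k p q (A : 'M[R]_k) (B : 'M[R]_(k, p)) (C : 'M[R]_(q, k))
  : \bar R :=
  if `[< hurwitz A >] then
    ereal_sup [set (sigma_max (tfun A B C (w%:C * 'i)))%:E | w in [set: R]]
  else +oo%E.

End Defs.

(* Main.v *)
(* Completing the square in the last block of coordinates eliminates it from
   Phi and, after the rescaling Xh = thetah X, leaves the bounded real LMI of the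
   error system perturbed by thetah |J^T X x|^2, which is harmless for small
   thetah. So the theorem is the strict bounded real lemma, for fixed Wh and Eh.

   Frequency inequality => LMI is proved by duality. If the LMI has no solution,
   a theorem of alternatives over positive semidefinite matrices gives a nonzero
   Z = V V^* with G X^* + X G^* = 0, where X and G = A X + B U are the state part
   and its derivative; such a V splits, up to a unitary factor, into columns with
   vanishing state and columns with g = i w x, on each of which the frequency
   inequality is contradicted. Positivity of the solution follows from Lyapunov's
   theorem, proved on a Schur triangular form of A. *)
Require Import Defs.
From HB Require Import structures.
From mathcomp Require Import all_boot all_order all_algebra.
From mathcomp Require Import complex spectral sesquilinear.
From mathcomp Require Import boolp classical_sets reals.
From mathcomp Require Import constructive_ereal ereal.
From mathcomp Require Import topology normedtype derive.
From mathcomp Require Import ring lra.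
Import Order.TTheory GRing.Theory Num.Theory numFieldNormedType.Exports.
Local Open Scope classical_set_scope.
Local Open Scope sesquilinear_scope.
Local Open Scope ring_scope.
Set Implicit Arguments.
Unset Strict Implicit.
Unset Printing Implicit Defensive.

(** * A theorem of alternatives for semidefinite matrices *)

Section PsdAlternative.
Variable R : realType.

Definition quad k (M : 'M[R]_k) (v : 'cV[R]_k) : R := (v^T *m M *m v) 0 0.

Definition psd k (M : 'M[R]_k) : Prop := M^T = M /\ forall v, 0 <= quad M v.

Lemma quadD k (M N : 'M[R]_k) v : quad (M + N) v = quad M v + quad N v.
Proof. by rewrite /quad mulmxDr mulmxDl mxE. Qed.

Lemma quadZ k a (M : 'M[R]_k) v : quad (a *: M) v = a * quad M v.
Proof. by rewrite /quad -scalemxAr -scalemxAl mxE. Qed.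

Lemma psdD k (M N : 'M[R]_k) : psd M -> psd N -> psd (M + N).
Proof.
move=> [sM pM] [sN pN]; split=> [|v]; first by rewrite linearD /= sM sN.
by rewrite quadD addr_ge0.
Qed.

Lemma psdZ k a (M : 'M[R]_k) : 0 <= a -> psd M -> psd (a *: M).
Proof.
move=> a0 [sM pM]; split=> [|v]; first by rewrite linearZ /= sM.
by rewrite quadZ mulr_ge0.
Qed.

Lemma norm2E k (v : 'cV[R]_k) : (v^T *m v) 0 0 = \sum_i v i 0 ^+ 2.
Proof. by rewrite mxE; apply: eq_bigr => i _; rewrite mxE expr2. Qed.

Lemma norm2_ge0 k (v : 'cV[R]_k) : 0 <= (v^T *m v) 0 0.
Proof. by rewrite norm2E sumr_ge0 // => i _; rewrite sqr_ge0. Qed.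

Lemma norm2_gt0 k (v : 'cV[R]_k) : v != 0 -> 0 < (v^T *m v) 0 0.
Proof.
move=> v0; rewrite lt_def norm2_ge0 andbT norm2E.
apply: contra v0; rewrite psumr_eq0 => [/allP v0|i _]; last exact: sqr_ge0.
apply/eqP/matrixP => i j; rewrite ord1 mxE; apply/eqP.
by rewrite -sqrf_eq0; exact: v0 (mem_index_enum _).
Qed.

Lemma psd_rank1 k (v : 'cV[R]_k) : psd (v *m v^T).
Proof.
split=> [|w]; first by rewrite trmx_mul trmxK.
rewrite /quad mulmxA -[_ *m v^T *m w]mulmxA.
have -> : v^T *m w = (w^T *m v)^T by rewrite trmx_mul trmxK.
by rewrite mxE big_ord1 [_^T _ _]mxE -expr2 sqr_ge0.
Qed.

Lemma quad_delta k (M : 'M[R]_k) i j s : M^T = M ->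
  quad M (delta_mx i 0 + s *: delta_mx j 0)
  = M i i + s *+ 2 * M i j + s ^+ 2 * M j j.
Proof.
move=> Ms.
have E a b : ((delta_mx 0 a : 'rV_k) *m M *m delta_mx b (0 : 'I_1)) 0 0 = M a b.
  by rewrite -rowE -colE !mxE.
rewrite /quad [(_ + _)^T]linearD /= [(_ *: _)^T]linearZ /= !trmx_delta !mulmxDl !mulmxDr.
rewrite -!scalemxAl -!scalemxAr.
have mxD (A B : 'M[R]_1) : (A + B) 0 0 = A 0 0 + B 0 0 by rewrite mxE.
have mxZ a (A : 'M[R]_1) : (a *: A) 0 0 = a * A 0 0 by rewrite mxE.
by rewrite !(mxD, mxZ) !E -[in M j i]Ms mxE; ring.
Qed.

Lemma psd_diag_ge0 k (M : 'M[R]_k) i : psd M -> 0 <= M i i.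
Proof.
move=> [Ms M0]; have := M0 (delta_mx i 0 + 0 *: delta_mx i 0).
by rewrite quad_delta //; lra.
Qed.

(** The test vectors e_i + e_j and e_i - e_j give 2 |M_ij| <= M_ii + M_jj. So the trace controls
    every entry: trace 1 gives a bounded set, and trace 0 forces the zero matrix. *)
Lemma psd_entry_bound k (M : 'M[R]_k) i j : psd M -> `|M i j| <= \tr M.
Proof.
move=> pM; have T a : M a a <= \tr M.
  by rewrite /mxtrace (bigD1 a) //= lerDl sumr_ge0 // => b _; apply: psd_diag_ge0.
case: pM => Ms M0.
have := M0 (delta_mx i 0 + 1 *: delta_mx j 0).
have := M0 (delta_mx i 0 + (-1) *: delta_mx j 0).
rewrite !quad_delta // => H1 H2; rewrite ler_norml.
by have := T i; have := T j; lra.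
Qed.

(** Stated for row vectors because the compactness argument below sees matrices through [vec_mx]. *)
Lemma linear_continuous_rV n (g : 'rV[R]_n -> R) :
  linear (g : 'rV[R]_n -> R^o) -> continuous g.
Proof.
move=> lg.
pose gl := GRing.isLinear.Build _ _ _ _ (g : _ -> R^o) lg.
pose g' : {linear 'rV[R]_n -> R^o} := HB.pack (g : _ -> R^o) gl.
have -> : g = (fun t => \sum_i t 0 i * g (delta_mx 0 i)).
  apply/funext => t; rewrite -[LHS]/(g' t) {1}[t]row_sum_delta linear_sum.
  by apply: eq_bigr => i _; rewrite linearZ.
apply: continuous_big => [|i _]; first exact: add_continuous.
move=> t; exact: (cvgM (@coord_continuous R 1 n 0 i t) (cvg_cst _)).
Qed.

(** First-order optimality at the left end of a segment, for a quadratic with slope 2 s and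
    second-order coefficient d. *)
Lemma slope_ge0 (s d : R) : 0 <= d ->
  (forall e, 0 <= e <= 1 -> 0 <= e *+ 2 * s + e ^+ 2 * d) -> 0 <= s.
Proof.
move=> d0 H; rewrite leNgt; apply/negP => s0.
have sd : 0 < d - s by lra.
(* This e lies in ]0, 1] and satisfies e d <= - s, so 2 e s + e^2 d <= e s < 0. *)
pose e := - s / (d - s).
have e0 : 0 < e by rewrite divr_gt0 // oppr_gt0.
have e1 : e <= 1 by rewrite ler_pdivrMr // mul1r; lra.
have ed : e * d <= - s.
  rewrite /e mulrAC ler_pdivrMr //; nra.
have /H : 0 <= e <= 1 by rewrite e1 ltW.
nra.
Qed.

(* c = L Z0, where Z0 minimizes |L Z|^2 over the compact convex set of positive
   semidefinite Z of trace 1, and d = |L Z0|^2. *)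
Lemma psd_alternative k a b (L : {linear 'M[R]_k -> 'M[R]_(a, b)}) :
  (forall Z, psd Z -> L Z = 0 -> Z = 0) ->
  exists (c : 'M[R]_(a, b)) (d : R), 0 < d /\
    forall v : 'cV[R]_k, d * (v^T *m v) 0 0 <= \tr (c^T *m L (v *m v^T)).
Proof.
(* In dimension 0 no matrix has trace 1, so this case is settled apart. *)
move=> L0; case: k L L0 => [|k] L L0.
  exists 0, 1; split=> // v.
  by rewrite [v]flatmx0 mulmx0 mxE mulr0 [X in X *m L _]trmx0 mul0mx mxtrace0.
pose T : set 'rV[R]_(k.+1 * k.+1) :=
  [set t | psd (vec_mx t : 'M_k.+1) /\ \tr (vec_mx t : 'M_k.+1) = 1].
pose ip (M N : 'M[R]_(a, b)) := \tr (M^T *m N).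
have ipC M N : ip M N = ip N M by rewrite /ip -mxtrace_tr trmx_mul trmxK.
have ipDr M N N' : ip M (N + N') = ip M N + ip M N'.
  by rewrite /ip mulmxDr mxtraceD.
have ipZr M x N : ip M (x *: N) = x * ip M N.
  by rewrite /ip -scalemxAr mxtraceZ.
have ipE M : ip M M = \sum_j \sum_i M i j ^+ 2.
  apply: eq_bigr => j _; rewrite mxE; apply: eq_bigr => i _.
  by rewrite mxE expr2.
have ip0 M : 0 <= ip M M.
  by rewrite ipE; do 2!apply: sumr_ge0 => ? _; rewrite sqr_ge0.
have ip_eq0 M : ip M M = 0 -> M = 0.
  rewrite ipE => /psumr_eq0P H; apply/matrixP => i j; rewrite mxE.
  have /psumr_eq0P H' : \sum_i M i j ^+ 2 = 0.
    by apply: H => // j' _; apply: sumr_ge0 => ? _; rewrite sqr_ge0.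
  by apply/eqP; rewrite -sqrf_eq0 H' // => i' _; rewrite sqr_ge0.
pose f t := ip (L (vec_mx t)) (L (vec_mx t)).
(* Boundedness is [psd_entry_bound]; closedness holds because [T] is cut out by closed conditions:
   one inequality per vector, one equation per pair of indices, and the trace. *)
have cT : compact T.
  apply: bounded_closed_compact.
    exists 1; split=> // x x1 t [/= pt t1]; apply: le_trans (ltW x1).
    rewrite /Num.norm /= mx_normrE; apply/bigmax_leP; split=> // -[i j] _ /=.
    rewrite -t1 ord1 -[t]vec_mxK; case/mxvec_indexP: j => j1 j2.
    by rewrite mxvecE vec_mxK psd_entry_bound.
  have -> : T = (\bigcap_(v in setT) [set t | 0 <= quad (vec_mx t : 'M_k.+1) v]) `&`
     ((\bigcap_(x in setT)
        [set t | (vec_mx t : 'M_k.+1) x.1 x.2 - (vec_mx t : 'M_k.+1) x.2 x.1 = 0])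
     `&` [set t | \tr (vec_mx t : 'M_k.+1) = 1]).
    apply/seteqP; split=> t /=.
      move=> [[st pt] tt]; split; [|split=> //] => [v _|[x y] _] //=.
      by have := congr1 (fun M : 'M_k.+1 => M x y) st; rewrite mxE => ->; rewrite subrr.
    move=> [pt [st tt]]; split=> //; split=> [|v]; last exact: pt.
    apply/matrixP => i j; rewrite mxE; apply/esym/eqP.
    by rewrite -subr_eq0; apply/eqP; exact: (st (i, j)).
  apply: closedI; last apply: closedI.
  - apply: closed_bigI => v _.
    apply: (@preimage_closed _ _ (fun t => quad (vec_mx t : 'M_k.+1) v)
      [set x | 0 <= x]).
      move=> ? _; apply: linear_continuous_rV => x t t'.
      by rewrite linearP /= quadD quadZ.
    exact: closed_ge.
  - apply: closed_bigI => -[x y] _.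
    apply: (@preimage_closed _ _ 
      (fun t => (vec_mx t : 'M_k.+1) x y - (vec_mx t : 'M_k.+1) y x) [set x | x = 0]).
      move=> ? _; apply: linear_continuous_rV => z t t'.
      by rewrite !mxE /GRing.scale /=; ring.
    exact: closed_eq.
  - apply: (@preimage_closed _ _ (fun t => \tr (vec_mx t : 'M_k.+1) : R)
      [set x : R | x = 1]).
      move=> ? _; apply: linear_continuous_rV => z t t'.
      by rewrite linearP /= mxtraceD mxtraceZ.
    exact: closed_eq.
have T0 : T !=set0.
  pose e0 : 'cV[R]_k.+1 := delta_mx 0 0.
  exists (mxvec (e0 *m e0^T)); rewrite /T /= mxvecK.
  split; first exact: psd_rank1.
  by rewrite mxtrace_mulC /e0 trmx_delta mul_delta_mx /mxtrace big_ord1 mxE.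
have cf : continuous f.
  have -> : f = fun t => \sum_j \sum_i L (vec_mx t) i j ^+ 2.
    by apply/funext => t; rewrite /f ipE.
  apply: continuous_big => [|j _]; first exact: add_continuous.
  apply: continuous_big => [|i _]; first exact: add_continuous.
  have cL : continuous (fun t => L (vec_mx t) i j).
    by apply: linear_continuous_rV => x t t'; rewrite !linearP !mxE.
  by move=> t; apply: (cvgM (cL t) (cL t)).
have [t0 /set_mem[pt0 tr0] t0min] := EVT_min_rV T0 cT (continuous_subspaceT cf).
set Z0 := vec_mx t0 in pt0 tr0; pose c := L Z0.
(* If c were 0, the hypothesis on [L] would give Z0 = 0, against trace 1. *)
have c_gt0 : 0 < ip c c.
  rewrite lt_def ip0 andbT; apply/eqP => /ip_eq0 /(L0 _ pt0) Z00.
  by move: tr0; rewrite Z00 mxtrace0 => /esym/eqP; rewrite oner_eq0.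
(* By convexity the segment from Z0 to Z stays in [T]; minimality at Z0 makes the slope <c, L Z - c>
   nonnegative. *)
have cT' Z : psd Z -> \tr Z = 1 -> ip c c <= ip c (L Z).
  move=> pZ tZ; rewrite -subr_ge0; apply: (@slope_ge0 _ _ (ip0 (L Z - c))).
  move=> e /andP[e0 e1].
  have /t0min : mxvec (Z0 + e *: (Z - Z0)) \in T.
    apply/mem_set; rewrite /T /= mxvecK; split; last first.
      by rewrite mxtraceD mxtraceZ linearB /= tr0 tZ subrr mulr0 addr0.
    have -> : Z0 + e *: (Z - Z0) = (1 - e) *: Z0 + e *: Z.
      by rewrite scalerBr scalerBl scale1r addrA addrAC.
    by apply: psdD; apply: psdZ; rewrite ?subr_ge0.
  rewrite /f mxvecK -/Z0 -/c linearD linearZ linearB /= -/c.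
  have [d dE] : exists d, d = L Z - c by eexists.
  rewrite -dE; have -> : L Z = c + d by rewrite dE addrC subrK.
  rewrite !ipDr ![ip (_ + _) _]ipC !ipDr !ipZr.
  rewrite ![ip (_ *: _) _]ipC !ipZr; lra.
exists c, (ip c c); split=> // v.
have [->|v0] := eqVneq v 0; first by
  rewrite !mulmx0 !mxE mulr0 mul0mx linear0 mulmx0 mxtrace0.
have vv := norm2_gt0 v0; rewrite mulrC -ler_pdivlMl //.
have E : \tr (v *m v^T) = (v^T *m v) 0 0 by rewrite mxtrace_mulC /mxtrace big_ord1.
have := cT' (((v^T *m v) 0 0)^-1 *: (v *m v^T)).
rewrite mxtraceZ [L (_ *: _)]linearZ /= ipZr E mulVf ?gt_eqF //; apply=> //.
by apply: psdZ (psd_rank1 v); rewrite invr_ge0 ltW.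
Qed.
End PsdAlternative.

(** * Hermitian matrices and their real parts *)

Section ComplexMatrices.
Variable R : realType.
Local Notation C := R[i].

Lemma cmxM a b c (M : 'M[R]_(a, b)) (N : 'M[R]_(b, c)) :
  cmx (M *m N) = cmx M *m cmx N.
Proof. exact: (map_mxM (real_complex R)). Qed.

Lemma cmxD a b (M N : 'M[R]_(a, b)) : cmx (M + N) = cmx M + cmx N.
Proof. exact: (map_mxD (real_complex R)). Qed.

Lemma cmx0 a b : cmx (0 : 'M[R]_(a, b)) = 0.
Proof. exact: (map_mx0 (real_complex R)). Qed.

Lemma cmx1 a : cmx (1%:M : 'M[R]_a) = 1%:M.
Proof. exact: (map_mx1 (real_complex R)). Qed.

Lemma conjCE (z : C) : Num.conj z = conjc z.
Proof. by []. Qed.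

Lemma adj_mul a b c (M : 'M[C]_(a, b)) (N : 'M[C]_(b, c)) :
  (M *m N)^t* = N^t* *m M^t*.
Proof. by rewrite trmx_mul map_mxM. Qed.

Lemma adjD a b (M N : 'M[C]_(a, b)) : (M + N)^t* = M^t* + N^t*.
Proof. by rewrite linearD /= map_mxD. Qed.

Lemma adjN a b (M : 'M[C]_(a, b)) : (- M)^t* = - M^t*.
Proof. by rewrite linearN /= map_mxN. Qed.

Lemma adj_cmx a b (M : 'M[R]_(a, b)) : (cmx M)^t* = cmx M^T.
Proof. by apply/matrixP => i j; rewrite !mxE conjCE /= oppr0. Qed.

Lemma adj_normE a b (M : 'M[C]_(a, b)) j :
  (M^t* *m M) j j = \sum_i `|M i j| ^+ 2.
Proof. by rewrite mxE; apply: eq_bigr => i _; rewrite !mxE normCKC. Qed.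

Lemma adj_mul_eq0 a b (M : 'M[C]_(a, b)) : M^t* *m M = 0 -> M = 0.
Proof.
move=> M0; apply/matrixP => i j.
have : (M^t* *m M) j j = 0 by rewrite M0 mxE.
rewrite adj_normE => /psumr_eq0P H; apply/eqP; rewrite mxE -normr_eq0.
by rewrite -sqrf_eq0 H // => k _; rewrite exprn_ge0.
Qed.

Lemma hermitian_diag n (H : 'M[C]_n) : H^t* = H ->
  exists (P : 'M[C]_n) (d : 'rV[R]_n),
    [/\ P *m P^t* = 1%:M, P^t* *m P = 1%:M &
        H = P^t* *m cmx (diag_mx d) *m P].
Proof.
move=> HH; have hH : H \is hermsymmx.
  by apply/is_hermitianmxP; rewrite expr0 scale1r HH.
have /orthomx_spectralP := hermitian_normalmx hH.
have := hermitian_spectral_diag_real hH.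
have := spectral_unitarymx H; set P := spectralmx H; set d := spectral_diag H.
move=> uP /mxOverP rd eH; exists P, (map_mx (@complex.Re R) d).
have PP := unitarymxP uP; split=> //; first exact: mulmx1C.
have -> : cmx (diag_mx (map_mx (@complex.Re R) d)) = diag_mx d.
  apply/matrixP => i j; rewrite !mxE raddfMn /=; congr (_ *+ _).
  by rewrite RRe_real.
by rewrite -invmx_unitary.
Qed.

Definition Rem a b (V : 'M[C]_(a, b)) : 'M[R]_(a, b) := map_mx (@complex.Re R) V.
Definition Imm a b (V : 'M[C]_(a, b)) : 'M[R]_(a, b) := map_mx (@complex.Im R) V.

Lemma Rem_mul a b c (M : 'M[C]_(a, b)) (N : 'M[C]_(b, c)) :
  Rem (M *m N) = Rem M *m Rem N - Imm M *m Imm N.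
Proof.
apply/matrixP => i j; rewrite !mxE (raddf_sum (@complex.Re R)) -sumrB.
by apply: eq_bigr => l _; rewrite !mxE; case: (M i l); case: (N l j).
Qed.

Lemma Imm_mul a b c (M : 'M[C]_(a, b)) (N : 'M[C]_(b, c)) :
  Imm (M *m N) = Rem M *m Imm N + Imm M *m Rem N.
Proof.
apply/matrixP => i j; rewrite !mxE (raddf_sum (@complex.Im R)) -big_split.
by apply: eq_bigr => l _; rewrite !mxE; case: (M i l); case: (N l j).
Qed.

Lemma Rem_cmx a b (M : 'M[R]_(a, b)) : Rem (cmx M) = M.
Proof. by apply/matrixP => i j; rewrite !mxE. Qed.

Lemma Imm_cmx a b (M : 'M[R]_(a, b)) : Imm (cmx M) = 0.
Proof. by apply/matrixP => i j; rewrite !mxE. Qed.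

Lemma Rem_adj a b (V : 'M[C]_(a, b)) : Rem (V^t*) = (Rem V)^T.
Proof. by apply/matrixP => i j; rewrite !mxE conjCE; case: (V j i). Qed.

Lemma Imm_adj a b (V : 'M[C]_(a, b)) : Imm (V^t*) = - (Imm V)^T.
Proof. by apply/matrixP => i j; rewrite !mxE conjCE; case: (V j i). Qed.

Lemma Rem_cmxl a b c (M : 'M[R]_(a, b)) (N : 'M[C]_(b, c)) :
  Rem (cmx M *m N) = M *m Rem N.
Proof. by rewrite Rem_mul Rem_cmx Imm_cmx mul0mx subr0. Qed.

Lemma Imm_cmxl a b c (M : 'M[R]_(a, b)) (N : 'M[C]_(b, c)) :
  Imm (cmx M *m N) = M *m Imm N.
Proof. by rewrite Imm_mul Rem_cmx Imm_cmx mul0mx addr0. Qed.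

(** The real part of v^* M v, written through real forms so that sign conditions on [quad] pass to
    complex vectors. *)
Definition hquad k (M : 'M[R]_k) (v : 'cV[C]_k) : R :=
  quad M (Rem v) + quad M (Imm v).

Lemma hquadE k (M : 'M[R]_k) (v : 'cV[C]_k) :
  hquad M v = complex.Re ((v^t* *m cmx M *m v) 0 0).
Proof.
have -> : complex.Re ((v^t* *m cmx M *m v) 0 0) = Rem (v^t* *m (cmx M *m v)) 0 0.
  by rewrite mulmxA [RHS]mxE.
rewrite Rem_mul Rem_cmxl Imm_cmxl Rem_adj Imm_adj mulNmx opprK !mulmxA.
by rewrite [RHS]mxE.
Qed.

(** V is P^* times the square roots of the eigenvalues, which are nonnegative as values of the form
    on the columns of P^*. V is complex because the diagonalization is the Hermitian one. *)
Lemma psd_factor n (Z : 'M[R]_n) : psd Z -> exists V : 'M[C]_n, V *m V^t* = cmx Z.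
Proof.
move=> [sZ pZ]; have [|P [d [PP PP' eZ]]] := @hermitian_diag n (cmx Z).
  by rewrite adj_cmx sZ.
have d0 i : 0 <= d 0 i.
  have -> : d 0 i = hquad Z (col i (P^t*)).
    rewrite hquadE.
    have -> : (col i (P^t*))^t* = row i P.
      by apply/matrixP => a b; rewrite !mxE conjCK.
    rewrite -row_mul.
    have -> : (row i (P *m cmx Z) *m col i (P^t*)) 0 0 = (P *m cmx Z *m P^t*) i i.
      by rewrite !mxE; apply: eq_bigr => l _; rewrite !mxE.
    by rewrite eZ !mulmxA PP mul1mx -mulmxA PP mulmx1 !mxE eqxx.
  by rewrite addr_ge0.
pose s := cmx (diag_mx (map_mx Num.sqrt d)); exists (P^t* *m s).
have ss : s *m s^t* = cmx (diag_mx d).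
  rewrite /s adj_cmx -cmxM tr_diag_mx mulmx_diag; congr (cmx (diag_mx _)).
  by apply/rowP => i; rewrite !mxE -expr2 sqr_sqrtr.
by rewrite adj_mul trmxCK eZ mulmxA -[P^t* *m s *m _]mulmxA ss.
Qed.

(* After diagonalizing X^* X = Lam, K = - Pi G^* X Lam^+ (Pi the projector on the
   nonzero part of Lam) is skew-Hermitian with X K = G Pi; P1 diagonalizes K on the
   range of Pi and P2 spans its complement. *)
Lemma skew_gram_split m k (X G : 'M[C]_(m, k)) :
  G *m X^t* + X *m G^t* = 0 ->
  exists (P1 P2 : 'M[C]_k) (w : 'rV[R]_k),
    [/\ P1 *m P1^t* + P2 *m P2^t* = 1%:M, X *m P2 = 0 &
        G *m P1 = X *m P1 *m ('i%C *: cmx (diag_mx w))].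
Proof.
move=> GX.
have [|Q [d [QQ QQ' eX]]] := @hermitian_diag k (X^t* *m X).
  by rewrite adj_mul trmxCK.
pose Pi := cmx (diag_mx (map_mx (fun x => (x != 0)%:R : R) d)).
(* Since [GRing.inv] sends 0 to 0, [Li] is the pseudo-inverse of [L]. *)
pose L := cmx (diag_mx d); pose Li := cmx (diag_mx (map_mx GRing.inv d)).
have LLi : L *m Li = Pi.
  rewrite /L /Li -cmxM mulmx_diag; congr (cmx (diag_mx _)).
  apply/rowP => i; rewrite !mxE; case: eqVneq => [->|d0]; first by rewrite mul0r.
  by rewrite mulfV.
have LiL : Li *m L = Pi by rewrite -LLi -!cmxM diag_mxC.
have PiL : Pi *m L = L.
  rewrite /L /Pi -cmxM mulmx_diag; congr (cmx (diag_mx _)).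
  by apply/rowP => i; rewrite !mxE; case: eqVneq => [->|d0]; rewrite ?mulr0 ?mul1r.
have PiPi : Pi *m Pi = Pi by rewrite -{2}LLi mulmxA PiL LLi.
have aL : L^t* = L by rewrite adj_cmx tr_diag_mx.
have aLi : Li^t* = Li by rewrite adj_cmx tr_diag_mx.
have aPi : Pi^t* = Pi by rewrite adj_cmx tr_diag_mx.
have [Y eY] : exists Y, Y = X *m Q^t* by eexists.
have [G' eG] : exists G', G' = G *m Q^t* by eexists.
have YY : Y^t* *m Y = L.
  rewrite eY adj_mul trmxCK -!mulmxA [X^t* *m _]mulmxA eX !mulmxA QQ mul1mx.
  by rewrite -mulmxA QQ mulmx1.
(* The Gram matrix of Y - Y Pi vanishes: the columns of Y belonging to a zero eigenvalue are
   zero. *)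
have YPi : Y *m Pi = Y.
  apply/eqP; rewrite eq_sym -subr_eq0; apply/eqP/adj_mul_eq0.
  rewrite adjD adjN [(Y *m Pi)^t*]adj_mul aPi.
  rewrite mulmxBl !mulmxBr !mulmxA YY.
  rewrite -[Pi *m Y^t* *m Y]mulmxA YY PiL.
  by rewrite subrr.
have GY : G' *m Y^t* = - (Y *m G'^t*).
  apply/eqP; rewrite -addr_eq0 eG eY !adj_mul !trmxCK.
  by rewrite !mulmxA -![_ *m Q^t* *m Q]mulmxA QQ' !mulmx1 GX.
pose K := - (Pi *m G'^t* *m Y *m Li).
(* The hypothesis, in the form [GY], yields a second expression of K, which is minus the adjoint of
   the first; hence K is skew. *)
have Ka : K = Li *m Y^t* *m G' *m Pi.
  rewrite -LLi -YY !mulmxA -[_ *m G' *m _]mulmxA GY mulmxN !mulNmx !mulmxA.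
  by rewrite -[Li *m Y^t* *m Y]mulmxA YY LiL.
have Kskew : K^t* = - K.
  rewrite [in RHS]Ka /K adjN ![(_ *m Li)^t*]adj_mul ![(_ *m Y)^t*]adj_mul.
  by rewrite ![(Pi *m _)^t*]adj_mul trmxCK aLi aPi !mulmxA.
have YK : Y *m K = G' *m Pi.
  rewrite /K mulmxN !mulmxA YPi -mulNmx -mulNmx -GY -!mulmxA [Y^t* *m _]mulmxA.
  by rewrite YY LLi.
(* i K is Hermitian with real eigenvalues w, so K has eigenvalues - i w; this is the origin of the
   witness [- w]. *)
have [|S [w [SS SS' eK]]] := @hermitian_diag k ('i%C *: K).
  rewrite linearZ /= map_mxZ Kskew scalerN -scaleNr; congr (_ *: _).
 by apply/eqP; rewrite eq_complex /= oppr0 opprK !eqxx.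
have {}eK : K = S^t* *m ('i%C *: cmx (diag_mx (- w))) *m S.
  have i0 : 'i%C != 0 :> C by rewrite eq_complex /= oner_eq0 andbF.
  apply: (scalerI i0).
  rewrite eK -scalemxAr -scalemxAl scalerA -expr2 sqr_i scaleN1r -mulNmx -mulmxN.
  have -> : - cmx (diag_mx (- w)) = cmx (diag_mx w); last by [].
  apply/matrixP => i j; rewrite !mxE.
  by apply/eqP; rewrite eq_complex /= mulNrn opprK oppr0 !eqxx.
exists (Q^t* *m Pi *m S^t*), (Q^t* *m (1%:M - Pi)), (- w); split.
- rewrite !adj_mul !trmxCK adjD adjN aPi trmx1 map_mx1 !mulmxA.
  rewrite -[_ *m S^t* *m S]mulmxA SS' mulmx1.
  rewrite -[_ *m Pi *m Pi]mulmxA PiPi -[_ *m _ *m (1%:M - Pi)]mulmxA.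
  have -> : (1%:M - Pi) *m (1%:M - Pi) = 1%:M - Pi.
    by rewrite mulmxBl mul1mx mulmxBr mulmx1 PiPi subrr subr0.
  by rewrite -mulmxDl -mulmxDr addrC subrK mulmx1.
- by rewrite mulmxA mulmxBr mulmx1 -eY YPi subrr.
- rewrite !mulmxA -eY -eG YPi -YK eK !mulmxA -[_ *m S *m S^t*]mulmxA SS mulmx1.
  by [].
Qed.
End ComplexMatrices.

(** * The Kalman-Yakubovich-Popov lemma *)

Section KYP.
Variable R : realType.
Local Notation C := R[i].

(** Reduces a trace against a Gram matrix to its columns, to which the frequency inequality applies
    one at a time. *)
Lemma mxtrace_gram k l (M : 'M[R]_k) (V : 'M[C]_(k, l)) :
  \tr (M *m Rem (V *m V^t*)) = \sum_j hquad M (col j V).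
Proof.
have T (U : 'M[R]_(k, l)) : \tr (M *m (U *m U^T)) = \sum_j quad M (col j U).
  rewrite mulmxA mxtrace_mulC mulmxA; apply: eq_bigr => j _.
  rewrite /quad tr_col -row_mul !mxE; apply: eq_bigr => i _.
  by rewrite !mxE.
rewrite Rem_mul Rem_adj Imm_adj mulmxN opprK mulmxDr mxtraceD !T -big_split /=.
apply: eq_bigr => j _; rewrite /hquad.
have -> : Rem (col j V) = col j (Rem V) by apply/matrixP => ? ?; rewrite !mxE.
by have -> : Imm (col j V) = col j (Imm V) by apply/matrixP => ? ?; rewrite !mxE.
Qed.

Lemma col_mulmx (S : nzRingType) a b c (M : 'M[S]_(a, b)) (N : 'M[S]_(b, c)) j :
  col j (M *m N) = M *m col j N.
Proof. by rewrite !colE mulmxA. Qed.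

Lemma mxtrace_rank1 (S : comNzRingType) a b (M : 'M[S]_(a, b)) (v : 'cV_b) (w : 'cV_a) :
  \tr (M *m (v *m w^T)) = (w^T *m M *m v) 0 0.
Proof. by rewrite mulmxA mxtrace_mulC mulmxA /mxtrace big_ord1. Qed.

Lemma mx11_tr (S : nzRingType) (M : 'M[S]_1) : M^T 0 0 = M 0 0.
Proof. by rewrite mxE. Qed.

Lemma mx11_mul (S : nzRingType) (M N : 'M[S]_1) : (M *m N) 0 0 = M 0 0 * N 0 0.
Proof. by rewrite mxE big_ord1. Qed.

Lemma mx11_add (S : nzRingType) (M N : 'M[S]_1) : (M + N) 0 0 = M 0 0 + N 0 0.
Proof. by rewrite mxE. Qed.

Lemma mx11_scale (S : nzRingType) x (M : 'M[S]_1) : (x *: M) 0 0 = x * M 0 0.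
Proof. by rewrite mxE. Qed.

Lemma hquad0 k (M : 'M[R]_k) : hquad M 0 = 0.
Proof. by rewrite hquadE mulmx0 mxE. Qed.

Lemma psd_ul a b (Z : 'M[R]_(a + b)) : psd Z -> psd (ulsubmx Z).
Proof.
move=> [sZ pZ]; split=> [|v]; first by rewrite trmx_ulsub sZ.
have := pZ (col_mx v 0).
rewrite /quad -[Z in _ *m Z *m _]submxK tr_col_mx trmx0 mul_row_block.
by rewrite !mul0mx !addr0 mul_row_col mulmx0 addr0.
Qed.

(** Adjoint, for the trace inner product, of the map P -> X^T P G + G^T P X that appears in the
    LMI. *)
Definition lyap m k (G X : 'M[R]_(m, k)) (Z : 'M[R]_k) : 'M[R]_m :=
  G *m Z *m X^T + X *m Z *m G^T.

(** * From a frequency inequality to a quadratic storage function *)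

Section FrequencyInequality.
Variables (m p : nat) (A : 'M[R]_m) (B : 'M[R]_(m, p)) (Th : 'M[R]_(m + p)).
(** A vector v stacks a state and an input. The case [usubmx v = 0] plays the part of infinite
    frequency. *)
Hypothesis freq : forall (w : R) (v : 'cV[C]_(m + p)), v != 0 ->
  usubmx v = 0 \/ cmx (row_mx A B) *m v = ('i%C * (w%:C)%C) *: usubmx v ->
  hquad Th v < 0.

Local Notation Ab := (row_mx A B).
Local Notation Ib := (row_mx 1%:M 0 : 'M[R]_(m, m + p)).

Lemma usubmxE a (v : 'M[C]_(m + p, a)) : usubmx v = cmx Ib *m v.
Proof.
rewrite -{2}[v]vsubmxK /cmx map_row_mx mul_row_col.
by rewrite -!/(cmx _) cmx1 cmx0 mul1mx mul0mx addr0.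
Qed.

(** Write Z = V V^* and split V by [skew_gram_split]. Each column of V P1 satisfies the state
    equation at some frequency, each column of V P2 has zero state, so all nonzero columns
    contribute negatively to the trace. *)
Lemma dual_trace_lt0 (Z : 'M[R]_(m + p)) :
  psd Z -> lyap Ab Ib Z = 0 -> 0 <= \tr (Th *m Z) -> Z = 0.
Proof.
move=> pZ MZ; have [V eV] := psd_factor pZ.
have [|P1 [P2 [w [PP XP2 GP1]]]] :=
    @skew_gram_split R m _ (usubmx V) (cmx Ab *m V).
  rewrite !usubmxE !adj_mul !mulmxA -[_ *m V *m V^t*]mulmxA.
  rewrite -[cmx Ib *m V *m _]mulmxA eV !adj_cmx -!cmxM -cmxD.
  by move: MZ; rewrite /lyap => ->; rewrite cmx0.
have eZ : cmx Z = (V *m P1) *m (V *m P1)^t* + (V *m P2) *m (V *m P2)^t*.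
  rewrite !adj_mul -eV !mulmxA -[V *m P1 *m _]mulmxA -[V *m P2 *m _]mulmxA.
  by rewrite -mulmxDl -mulmxDr PP mulmx1.
have H1 j : hquad Th (col j (V *m P1)) <= 0 ?= iff (col j (V *m P1) == 0).
  apply/leifP; case: eqVneq => [->|n0]; first by rewrite hquad0.
  apply: (freq (w := w 0 j)) => //; right.
  rewrite usubmxE -!col_mulmx !mulmxA -usubmxE GP1 -scalemxAr.
  rewrite /cmx map_diag_mx mul_mx_diag.
  by apply/matrixP => a b; rewrite !mxE mulrAC mulrA.
have H2 j : hquad Th (col j (V *m P2)) <= 0 ?= iff (col j (V *m P2) == 0).
  apply/leifP; case: eqVneq => [->|n0]; first by rewrite hquad0.
  apply: (freq (w := 0)) => //; left.
  by rewrite usubmxE -col_mulmx mulmxA -usubmxE XP2 col0.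
have -> : Z = Rem (cmx Z) by rewrite Rem_cmx.
rewrite eZ; have RD (M N : 'M[C]_(m + p)) : Rem (M + N) = Rem M + Rem N.
  by apply/matrixP => i j; rewrite !mxE raddfD.
rewrite RD mulmxDr mxtraceD !mxtrace_gram => T0.
(* [leif] keeps the equality case: the sums are nonpositive, and zero only if every column is
   zero. *)
have S1 := leif_sum (fun j (_ : true) => H1 j).
have S2 := leif_sum (fun j (_ : true) => H2 j).
rewrite !big1_eq in S1 S2.
have V0 (M : 'M[C]_(m + p)) : [forall j, col j M == 0] -> M = 0.
  move=> /forallP H; apply/matrixP => i j.
  by have /eqP/matrixP/(_ i 0) := H j; rewrite !mxE.
have/V0 -> : [forall j, col j (V *m P1) == 0].
  by rewrite -S1.2; apply/eqP; have := S1.1; have := S2.1; lra.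
have/V0 -> : [forall j, col j (V *m P2) == 0].
  by rewrite -S2.2; apply/eqP; have := S1.1; have := S2.1; lra.
by rewrite !mul0mx; apply/matrixP => i j; rewrite !mxE addr0.
Qed.

(* The extra coordinate of Z is a slack: L Z = 0 forces the trace of Th Z to equal
   it, hence to be nonnegative. *)
Lemma kyp : exists (X : 'M[R]_m) (d : R), [/\ X^T = X, 0 < d &
  forall v : 'cV[R]_(m + p),
    ((usubmx v)^T *m X *m (Ab *m v)) 0 0 *+ 2 + quad Th v
      <= - (d * (v^T *m v) 0 0)].
Proof.
(* Both dual constraints are packed as the diagonal blocks of one linear map: the Lyapunov equation,
   and trace minus slack. *)
pose f (Z : 'M[R]_((m + p) + 1)) : 'M[R]_(m + 1) :=
  block_mx (lyap Ab Ib (ulsubmx Z)) 0 0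
    ((\tr (Th *m ulsubmx Z))%:M - drsubmx Z).
have lf : linear f.
  move=> x Z Z'; rewrite /f.
  have -> : ulsubmx (x *: Z + Z') = x *: ulsubmx Z + ulsubmx Z'.
    by apply/matrixP => i j; rewrite !mxE.
  have -> : drsubmx (x *: Z + Z') = x *: drsubmx Z + drsubmx Z'.
    by apply/matrixP => i j; rewrite !mxE.
  rewrite /lyap.
  rewrite !(mulmxDr, mulmxDl) -!scalemxAr -!scalemxAl.
  rewrite scale_block_mx add_block_mx !scaler0 !addr0 mxtraceD mxtraceZ.
  congr (block_mx _ _ _ _); first by rewrite scalerDr addrACA.
  rewrite scalerBr raddfD /= -scale_scalar_mx.
  by rewrite opprD addrACA.
pose fl := GRing.isLinear.Build _ _ _ _ f lf.
pose f' : {linear _ -> _} := HB.pack f fl.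
have [Z pZ|c [d [d0 H]]] := @psd_alternative R _ _ _ f'.
  rewrite -[f' Z]/(f Z) /f -[0 in RHS](@block_mx0 _ m 1 m 1) => /eq_block_mx[Z1 _ _ Z2].
  have pul := psd_ul pZ.
  have tr2 : \tr (drsubmx Z) = \tr (Th *m ulsubmx Z).
    move/eqP: Z2; rewrite subr_eq0 => /eqP <-.
    by rewrite mxtrace_scalar mulr1n.
  have dr0 : 0 <= \tr (drsubmx Z).
    by apply: sumr_ge0 => i _; rewrite !mxE psd_diag_ge0.
  rewrite tr2 in dr0; have ul0 := dual_trace_lt0 pul Z1 dr0.
  apply/matrixP => i j; rewrite mxE; apply/eqP; rewrite -normr_le0.
  apply: le_trans (psd_entry_bound i j pZ) _.
  by rewrite -[Z]submxK mxtrace_block tr2 ul0 mulmx0 mxtrace0 addr0.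
(* The blocks of c are the multipliers: a, once symmetrized, for the Lyapunov constraint and b for
   the trace. *)
pose b := drsubmx c 0 0; pose a := ulsubmx c.
have fE (v : 'cV[R]_(m + p)) (s : 'M[R]_1) :
  \tr (c^T *m f (col_mx v s *m (col_mx v s)^T)) =
  ((usubmx v)^T *m (a + a^T) *m (Ab *m v)) 0 0 + b * (quad Th v - s 0 0 ^+ 2).
  rewrite /f tr_col_mx mul_col_row block_mxKul block_mxKdr.
  rewrite -{1}[c]submxK tr_block_mx mulmx_block mxtrace_block !mulmx0 addr0 add0r.
  congr (_ + _); last first.
    rewrite [drsubmx c]mx11_scalar tr_scalar_mx -/b mul_scalar_mx mxtraceZ.
    congr (_ * _); rewrite linearB /= mxtrace_scalar mulr1n; congr (_ - _).
      by rewrite mulmxA mxtrace_mulC mulmxA /mxtrace big_ord1.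
    by rewrite /mxtrace big_ord1 !mxE big_ord1 mxE expr2.
  have uE : usubmx v = Ib *m v.
    by rewrite -{2}[v]vsubmxK mul_row_col mul1mx mul0mx addr0.
  rewrite -/a /lyap mulmxDr mxtraceD !mulmxA -![_ *m v *m v^T *m _]mulmxA.
  rewrite -!trmx_mul -uE -![_ *m v *m _]mulmxA.
  rewrite !mxtrace_rank1 mulmxDr mulmxDl mulmxDl [RHS]mxE addrC !mulmxA; congr (_ + _).
  by rewrite -mx11_tr !trmx_mul !trmxK uE !trmx_mul !mulmxA.
(* Testing on zero state and input with slack coordinate 1 gives d <= - b. *)
have b0 : b < 0.
  have := H (col_mx 0 1%:M); rewrite -[f' _]/(f _) fE.
  rewrite tr_col_mx mul_row_col trmx0 mul0mx add0r trmx1 mul1mx /quad !mulmx0 !mxE.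
  by rewrite /= => ?; lra.
(* Dividing by b < 0 normalizes the coefficient of [Th] to 1 and reverses the inequality; the 2
   compensates for the doubled cross term. *)
exists ((b *+ 2)^-1 *: (a + a^T)), (- (d / b)); split.
- by rewrite linearZ /= linearD /= trmxK addrC.
- by rewrite -mulrN -invrN divr_gt0 ?oppr_gt0.
move=> v; have := H (col_mx v 0).
rewrite -[f' _]/(f _) fE.
rewrite tr_col_mx mul_row_col mulmx0 addr0 [X in _ - X ^+ 2]mxE expr0n subr0.
rewrite -scalemxAr -scalemxAl.
rewrite mx11_scale; set P := (_ *m (a + a^T) *m _) 0 0; set Q := (v^T *m v) 0 0 => E.
have b_neq0 : b != 0 by rewrite lt_eqF.
have -> : (b *+ 2)^-1 * P *+ 2 + quad Th v = (P + b * quad Th v) / b by field.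
have -> : - (- (d / b) * Q) = d * Q / b by field.
by rewrite ler_nM2r // invr_lt0.
Qed.

End FrequencyInequality.
End KYP.

(** * Lyapunov's theorem *)

Section Lyapunov.
Variable R : realType.
Local Notation C := R[i].

Lemma unitmx_ker0 (F : fieldType) n (M : 'M[F]_n) :
  (forall v : 'cV_n, M *m v = 0 -> v = 0) -> M \in unitmx.
Proof.
move=> inj; rewrite -unitmx_tr -row_free_unit -kermx_eq0; apply/eqP/row_matrixP => i.
rewrite row0; apply: trmx_inj; rewrite trmx0; apply: inj.
by apply: trmx_inj; rewrite trmx_mul trmxK -row_mul mulmx_ker row0 trmx0.
Qed.

(* With T lower triangular, the vectors with zero first coordinate are T-invariant;
   w spans their X-orthogonal complement, and T w = t w modulo them. *)
Lemma trig_lyapunov n (T X : 'M[C]_n) :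
  is_trig_mx T -> (forall i, complex.Re (T i i) < 0) -> X^t* = X ->
  (forall v : 'cV_n, v != 0 -> complex.Re ((v^t* *m X *m T *m v) 0 0) < 0) ->
  forall v : 'cV_n, v != 0 -> 0 < complex.Re ((v^t* *m X *m v) 0 0).
Proof.
elim: n T X => [|n IH] T X trT reT hX XT v v0.
  by move: v0; rewrite [v]flatmx0 eqxx.
rewrite -[n.+1]/(1 + n)%N in T X trT reT hX XT v v0 *.
pose t := ulsubmx T; pose c := dlsubmx T; pose T' := drsubmx T.
pose x := ulsubmx X; pose b := dlsubmx X; pose X' := drsubmx X.
have eT : T = block_mx t 0 c T'.
  rewrite -{1}[T]submxK; congr block_mx; apply/matrixP => i j; rewrite !mxE.
  by apply: (is_trig_mxP trT); rewrite /= ord1.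
have eX : X = block_mx x (b^t*) b X'.
  rewrite -{1}[X]submxK; congr block_mx; rewrite -{1}hX.
  by apply/matrixP => i j; rewrite !mxE; congr (Num.conj (X _ _)); apply: val_inj.
have hX' : X'^t* = X'.
  have hXe i j : X i j = Num.conj (X j i) by rewrite -{1}hX !mxE.
  by apply/matrixP => i j; rewrite !mxE -hXe.
(* Vectors with zero first coordinate are T-invariant, so the hypotheses restrict to the lower
   blocks and the induction applies. *)
have X'0 : forall y : 'cV_n, y != 0 -> 0 < complex.Re ((y^t* *m X' *m y) 0 0).
  apply: (IH T' X') => // [|i|y y0].
  - apply/is_trig_mxP => i j ij; rewrite !mxE.
    by apply: (is_trig_mxP trT).
  - by rewrite !mxE.
  have /XT : col_mx (0 : 'M_1) y != 0.
    by apply: contra y0 => /eqP; rewrite -col_mx0 => /eq_col_mx[_ ->].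
  rewrite eT eX tr_col_mx map_row_mx trmx0 map_mx0 -!mulmxA mul_block_col.
  rewrite !mulmx0 mul0mx !add0r mul_block_col mulmx0 add0r mul_row_col mul0mx add0r.
  by rewrite mulmx0 add0r !mulmxA.
have uX' : X' \in unitmx.
  apply: unitmx_ker0 => y Xy; apply/eqP; apply: contraT => /X'0.
  by rewrite -mulmxA Xy mulmx0 mxE /= ltxx.
(* This z cancels the lower part of X w; the remaining entry xi is the Schur complement of X' in
   X. *)
pose z := - (invmx X' *m b); pose w := col_mx (1%:M : 'M[C]_1) z.
have [xi xiE] : exists xi, xi = x + b^t* *m z by eexists.
have Xw : X *m w = col_mx xi 0.
  rewrite eX mul_block_col !mulmx1 xiE; congr col_mx.
  by rewrite /z mulmxN mulmxA mulmxV // mul1mx subrr.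
have wX : w^t* *m X = row_mx (xi^t*) 0.
  by rewrite -hX -adj_mul Xw tr_col_mx map_row_mx trmx0 map_mx0.
have w0 : w != 0.
  apply/eqP; rewrite -col_mx0 => /eq_col_mx[/matrixP/(_ 0 0)].
  by rewrite !mxE /= => /eqP; rewrite oner_eq0.
have wXw : w^t* *m X *m w = xi^t*.
  by rewrite wX mul_row_col mul0mx addr0 mulmx1.
have xi_re : xi^t* = xi.
  by rewrite -[RHS]trmxCK -wXw !adj_mul trmxCK hX mulmxA.
have xi_conj : conjc (xi 0 0) = xi 0 0 by rewrite -[in RHS]xi_re !mxE.
have xi_im : complex.Im (xi 0 0) = 0.
  by move: xi_conj; case: (xi 0 0) => a' b' [] /= ?; lra.
(* Here w^* X T w = xi t with xi real, and both this value and t have negative real part. *)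
have xi0 : 0 < complex.Re (xi 0 0).
  have := XT w w0; rewrite wX eT /w mul_row_block mul_row_col !mulmx0 !mul0mx !addr0.
  rewrite mul0mx addr0 mulmx1 xi_re mx11_mul.
  have := reT (lshift n 0); have -> : T (lshift n 0) (lshift n 0) = t 0 0 by rewrite !mxE.
  move: xi_im; case: (xi 0 0) => a' b' /= ->; case: (t 0 0) => c' d' /=.
  by rewrite mul0r subr0 => ?; rewrite nmulr_llt0.
pose s := usubmx v; have [y yE] : exists y, y = dsubmx v - z *m s by eexists.
(* The two summands are X-orthogonal, so the form at v splits into |s|^2 xi and the form of X' at
   y. *)
have ev : v = w *m s + col_mx 0 y.
  by rewrite /w mul_col_mx mul1mx add_col_mx addr0 yE addrC subrK vsubmxK.
have yX : (col_mx (0 : 'M_1) y)^t* *m (X *m w) = 0.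
  by rewrite Xw tr_col_mx map_row_mx mul_row_col mulmx0 addr0 trmx0 map_mx0 mul0mx.
have Xy : w^t* *m X *m col_mx 0 y = 0 by rewrite wX mul_row_col mulmx0 mul0mx addr0.
have yXy : (col_mx (0 : 'M_1) y)^t* *m X *m col_mx 0 y = y^t* *m X' *m y.
  rewrite eX tr_col_mx map_row_mx trmx0 map_mx0 mul_row_block mul_row_col.
  by rewrite !mul0mx !add0r mulmx0 add0r.
have -> : v^t* *m X *m v = s^t* *m xi *m s + y^t* *m X' *m y.
  rewrite {1 2}ev adjD !mulmxDl !mulmxDr yXy adj_mul; congr (_ + _).
    rewrite -xi_re -wXw !mulmxA.
    have -> : s^t* *m w^t* *m X *m col_mx 0 y = 0.
      by rewrite -!mulmxA [w^t* *m _]mulmxA Xy mulmx0.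
    by rewrite addr0.
  have -> : (col_mx (0 : 'M_1) y)^t* *m X *m (w *m s) = 0.
    by rewrite -mulmxA [X *m (w *m s)]mulmxA mulmxA yX mul0mx.
  by rewrite add0r.
rewrite mx11_add raddfD /= !mx11_mul.
have -> : complex.Re ((s^t*) 0 0 * xi 0 0 * s 0 0)
    = ((complex.Re (s 0 0)) ^+ 2 + (complex.Im (s 0 0)) ^+ 2) * complex.Re (xi 0 0).
  rewrite !mxE; move: xi_im; case: (xi 0 0) => a' b' /= ->; case: (v _ _) => p q /=.
  ring.
have [s0|s0] := eqVneq s 0.
  rewrite s0 mxE /= expr0n addr0 mul0r add0r; apply: X'0.
  apply: contra v0 => /eqP y0; rewrite ev s0 y0 mulmx0 add0r col_mx0.
  exact: eqxx.
rewrite ltr_wpDr //.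
  have [->|y0] := eqVneq y 0; first by rewrite mulmx0 mxE.
  exact/ltW/X'0.
rewrite mulr_gt0 // lt_def addr_ge0 ?sqr_ge0 // andbT.
apply: contra s0; rewrite paddr_eq0 ?sqr_ge0 // !sqrf_eq0 => s0.
by apply/eqP/matrixP => i j; rewrite !ord1 [RHS]mxE; apply/eqP; rewrite eq_complex.
Qed.

Lemma hquad_lt0 k (M : 'M[R]_k) (y : 'cV[C]_k) :
  (forall v, v != 0 -> quad M v < 0) -> y != 0 -> hquad M y < 0.
Proof.
move=> M0 y0.
have Mle v : quad M v <= 0.
  have [->|/M0/ltW//] := eqVneq v 0; by rewrite /quad mulmx0 mxE.
have [yr|/M0 ?] := eqVneq (Rem y) 0; last by rewrite /hquad ltr_nwDl.
have [yi|/M0 ?] := eqVneq (Imm y) 0; last by rewrite /hquad ltr_nwDr.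
case/eqP: y0; apply/matrixP => i j.
move/matrixP/(_ i j): yr; move/matrixP/(_ i j): yi; rewrite !mxE.
by case: (y i j) => /= ? ? -> ->.
Qed.

(** A unitary Schur basis makes A triangular with its eigenvalues on the diagonal. Both quadratic
    forms are transported by the same unitary matrix, which reduces the claim to [trig_lyapunov]. *)
Lemma lyapunov_posdef k (A X : 'M[R]_k) : hurwitz A -> X^T = X ->
  (forall v : 'cV_k, v != 0 -> quad (X *m A) v < 0) -> posdef X.
Proof.
move=> hA sX XA; split=> // v v0; case: k => [|k] in A X hA sX XA v v0 *.
  by move: v0; rewrite [v]flatmx0 eqxx.
have [P uP trP] := Schur (cmx A) isT.
set T := conjmx P (cmx A) in trP; have PP := unitarymxP uP.
have PP' := mulmx1C PP.
have eT : T = P *m cmx A *m P^t* by rewrite /T conjymx.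
have quadP (M : 'M[R]_k.+1) y : complex.Re ((y^t* *m (P *m cmx M *m P^t*) *m y) 0 0)
    = hquad M (P^t* *m y).
  by rewrite hquadE adj_mul trmxCK !mulmxA.
have P0 (y : 'cV[C]_k.+1) : y != 0 -> P^t* *m y != 0.
  by apply: contra => /eqP Py; rewrite -[y]mul1mx -PP -mulmxA Py mulmx0.
have := @trig_lyapunov _ T (P *m cmx X *m P^t*) trP _ _ _ (P *m cmx v).
rewrite quadP mulmxA PP' mul1mx /hquad Rem_cmx Imm_cmx.
have -> : quad X 0 = 0 by rewrite /quad mulmx0 mxE.
rewrite addr0; apply.
- move=> i; apply: hA; apply: (@eigenvalue_conjmx _ _ _ P).
  + by rewrite stablemx_unit // unitarymx_unit.
  + by rewrite row_free_unit unitarymx_unit.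
  rewrite -[_ \in _]/(eigenvalue T (T i i)) eigenvalue_root_char char_poly_trig // /root.
  by rewrite horner_prod (bigD1 i) //= hornerXsubC subrr mul0r.
- by rewrite !adj_mul trmxCK adj_cmx sX mulmxA.
- move=> y y0.
  have -> : y^t* *m (P *m cmx X *m P^t*) *m T *m y =
      y^t* *m (P *m cmx (X *m A) *m P^t*) *m y.
    by rewrite eT cmxM !mulmxA -[_ *m P^t* *m P]mulmxA PP' mulmx1.
  by rewrite quadP hquad_lt0 // P0.
- apply: contra v0 => /eqP Pv; apply/eqP.
  rewrite -[v]Rem_cmx -[cmx v]mul1mx -PP' -mulmxA Pv mulmx0.
  by apply/matrixP => i j; rewrite !mxE.
Qed.
End Lyapunov.

(** * The bounded real lemma *)

Section Dot.
Variable R : realType.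
Local Notation C := R[i].

Definition dot k (a b : 'cV[R]_k) : R := (a^T *m b) 0 0.

Lemma dotC k (a b : 'cV[R]_k) : dot a b = dot b a.
Proof. by rewrite /dot -mx11_tr trmx_mul trmxK. Qed.

Lemma dotDr k (a b c : 'cV[R]_k) : dot a (b + c) = dot a b + dot a c.
Proof. by rewrite /dot mulmxDr mx11_add. Qed.

Lemma dotDl k (a b c : 'cV[R]_k) : dot (a + b) c = dot a c + dot b c.
Proof. by rewrite dotC dotDr ![dot c _]dotC. Qed.

Lemma dotZr k (a b : 'cV[R]_k) x : dot a (x *: b) = x * dot a b.
Proof. by rewrite /dot -scalemxAr mx11_scale. Qed.

Lemma dotZl k (a b : 'cV[R]_k) x : dot (x *: a) b = x * dot a b.
Proof. by rewrite dotC dotZr dotC. Qed.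

Lemma dotNr k (a b : 'cV[R]_k) : dot a (- b) = - dot a b.
Proof. by rewrite -scaleN1r dotZr mulN1r. Qed.

Lemma dotNl k (a b : 'cV[R]_k) : dot (- a) b = - dot a b.
Proof. by rewrite dotC dotNr dotC. Qed.

Lemma dot0r k (a : 'cV[R]_k) : dot a 0 = 0.
Proof. by rewrite /dot mulmx0 mxE. Qed.

Lemma dot0l k (a : 'cV[R]_k) : dot 0 a = 0.
Proof. by rewrite dotC dot0r. Qed.

Lemma dot_mull k l (M : 'M[R]_(k, l)) a b : dot (M *m a) b = dot a (M^T *m b).
Proof. by rewrite /dot trmx_mul mulmxA. Qed.

Lemma dot_col_mx k l (a c : 'cV[R]_k) (b d : 'cV[R]_l) :
  dot (col_mx a b) (col_mx c d) = dot a c + dot b d.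
Proof. by rewrite /dot tr_col_mx mul_row_col mx11_add. Qed.

Lemma quad_dot k (M : 'M[R]_k) v : quad M v = dot v (M *m v).
Proof. by rewrite /quad /dot mulmxA. Qed.

Lemma dot_ge0 k (a : 'cV[R]_k) : 0 <= dot a a.
Proof. exact: norm2_ge0. Qed.

Lemma dot_gt0 k (a : 'cV[R]_k) : a != 0 -> 0 < dot a a.
Proof. exact: norm2_gt0. Qed.

Lemma dot_mulmx_bound k l (M : 'M[R]_(k, l)) :
  exists K, 0 <= K /\ forall a, dot (M *m a) (M *m a) <= K * dot a a.
Proof.
exists (\sum_i (\sum_j `|M i j|) ^+ 2); split.
  by apply: sumr_ge0 => i _; rewrite sqr_ge0.
move=> a; rewrite {1}/dot norm2E mulr_suml; apply: ler_sum => i _.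
have ha j : `|a j 0| <= Num.sqrt (dot a a).
  rewrite -sqrtr_sqr; apply: ler_wsqrtr.
  by rewrite /dot norm2E (bigD1 j) //= lerDl sumr_ge0 // => ? _; rewrite sqr_ge0.
rewrite -[dot a a]sqr_sqrtr ?dot_ge0 // -exprMn -real_normK ?num_real //.
rewrite lerXn2r ?nnegrE ?mulr_ge0 ?sqrtr_ge0 ?sumr_ge0 //.
rewrite mxE mulr_suml; apply: le_trans (ler_norm_sum _ _ _) _.
by apply: ler_sum => j _; rewrite normrM ler_wpM2l.
Qed.

(** The square of [cvnorm], kept without the root so that it is a quadratic form. *)
Definition hnorm k (u : 'cV[C]_k) : R := dot (Rem u) (Rem u) + dot (Imm u) (Imm u).

Lemma hnorm_ge0 k (u : 'cV[C]_k) : 0 <= hnorm u.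
Proof. by rewrite addr_ge0 ?dot_ge0. Qed.

Lemma hnorm_hquad k (u : 'cV[C]_k) : hnorm u = hquad 1%:M u.
Proof. by rewrite /hnorm /hquad !quad_dot !mul1mx. Qed.

Lemma hnorm_gt0 k (u : 'cV[C]_k) : u != 0 -> 0 < hnorm u.
Proof.
move=> u0; have := @hquad_lt0 _ _ (- 1%:M) u _ u0.
rewrite /hquad !quad_dot !mulNmx !mul1mx !dotNr -opprD oppr_lt0; apply.
by move=> v v0; rewrite quad_dot mulNmx mul1mx dotNr oppr_lt0 dot_gt0.
Qed.

Lemma cvnormE k (u : 'cV[C]_k) : cvnorm u = Num.sqrt (hnorm u).
Proof.
rewrite /cvnorm /hnorm /dot !norm2E -big_split /=; congr (Num.sqrt _).
by apply: eq_bigr => j _; rewrite !mxE.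
Qed.

Lemma hnormZ k (a : R) (u : 'cV[C]_k) : hnorm ((a%:C)%C *: u) = a ^+ 2 * hnorm u.
Proof.
have -> : (a%:C)%C *: u = cmx (a%:M) *m u.
  by rewrite /cmx (map_scalar_mx (real_complex R)) mul_scalar_mx.
rewrite /hnorm Rem_cmxl Imm_cmxl !mul_scalar_mx !dotZl !dotZr; ring.
Qed.

(** Any finite constant will do: it makes the set whose supremum is [sigma_max] bounded. The factor
    2 comes from |a - d|^2 <= 2 |a|^2 + 2 |d|^2. *)
Lemma hnorm_mulmx_bound k l (M : 'M[C]_(k, l)) :
  exists K, 0 <= K /\ forall u, hnorm (M *m u) <= K * hnorm u.
Proof.
have [K1 [K1_0 H1]] := dot_mulmx_bound (Rem M).
have [K2 [K2_0 H2]] := dot_mulmx_bound (Imm M).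
exists (2%:R * (K1 + K2)); split; first by rewrite mulr_ge0 ?addr_ge0.
move=> u; rewrite /hnorm Rem_mul Imm_mul.
have := H1 (Rem u); have := H1 (Imm u); have := H2 (Rem u); have := H2 (Imm u).
move: (Rem M *m Rem u) (Rem M *m Imm u) (Imm M *m Rem u) (Imm M *m Imm u).
move=> a b c d.
have sq (x y : 'cV[R]_k) : 0 <= dot (x + y) (x + y) /\ 0 <= dot (x - y) (x - y).
  by rewrite !dot_ge0.
have [] := sq a d; have [] := sq b c.
rewrite !(dotDl, dotDr, dotNl, dotNr) [dot d a]dotC [dot c b]dotC.
lra.
Qed.

Lemma cvnorm_le_sigma_max k l (M : 'M[C]_(k, l)) u :
  cvnorm (M *m u) <= sigma_max M * cvnorm u.
Proof.
have [->|u0] := eqVneq u 0.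
  rewrite mulmx0 !cvnormE; have -> : hnorm (0 : 'cV[C]_k) = 0.
    by rewrite hnorm_hquad hquad0.
  have -> : hnorm (0 : 'cV[C]_l) = 0 by rewrite hnorm_hquad hquad0.
  by rewrite sqrtr0 mulr0.
have [K [K0 HK]] := hnorm_mulmx_bound M.
have nu : 0 < cvnorm u by rewrite cvnormE sqrtr_gt0 hnorm_gt0.
rewrite -ler_pdivrMr //.
pose t := (cvnorm u)^-1.
have nZ j (v : 'cV[C]_j) : cvnorm ((t%:C)%C *: v) = t * cvnorm v.
  by rewrite !cvnormE hnormZ sqrtrM ?sqr_ge0 // sqrtr_sqr ger0_norm // invr_ge0 ltW.
rewrite mulrC -/t -nZ scalemxAr; apply: ub_le_sup.
  exists (Num.sqrt K) => _ [v /= v1 <-]; rewrite cvnormE.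
  apply: ler_wsqrtr; apply: le_trans (HK _) _.
  rewrite -[leRHS]mulr1 ler_wpM2l //.
  by move: v1; rewrite cvnormE -{1}sqrtr1 ler_sqrt.
by exists ((t%:C)%C *: u) => //=; rewrite nZ mulVf // gt_eqF.
Qed.

Lemma sigma_max_le k l (M : 'M[C]_(k, l)) c : 0 <= c ->
  (forall u, cvnorm (M *m u) <= c * cvnorm u) -> sigma_max M <= c.
Proof.
move=> c0 H; apply: ge_sup.
  exists (cvnorm (M *m 0)), 0 => //=.
  by rewrite cvnormE hnorm_hquad hquad0 sqrtr0 ler01.
move=> _ [u /= u1 <-]; apply: le_trans (H u) _.
by rewrite -[leRHS]mulr1 ler_wpM2l.
Qed.

(** Strict negativity becomes uniform by [psd_alternative] applied to Z -> tr (M Z), whose only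
    positive semidefinite zero is Z = 0. *)
Lemma negdef_bound k (M : 'M[R]_k) : (forall v, v != 0 -> quad M v < 0) ->
  exists e, 0 < e /\ forall v, quad M v <= - (e * dot v v).
Proof.
move=> M0.
pose f (Z : 'M[R]_k) : 'M[R]_1 := (\tr (M *m Z))%:M.
have lf : linear f.
  move=> x Z Z'; rewrite /f mulmxDr -scalemxAr mxtraceD mxtraceZ.
  by rewrite raddfD /= scale_scalar_mx.
pose fl := GRing.isLinear.Build _ _ _ _ f lf.
pose f' : {linear _ -> _} := HB.pack f fl.
have [Z pZ|c [d [d0 H]]] := @psd_alternative R _ _ _ f'.
  rewrite -[f' Z]/(f Z) /f => /(congr1 (fun A : 'M[R]_1 => A 0 0)).
  rewrite !mxE eqxx mulr1n; have [V eV] := psd_factor pZ.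
  rewrite -[Z]Rem_cmx -eV mxtrace_gram => S0.
  have H j : hquad M (col j V) <= 0 ?= iff (col j V == 0).
    apply/leifP; case: eqVneq => [->|n0]; first by rewrite hquad0.
    exact: hquad_lt0.
  have S := leif_sum (fun j (_ : true) => H j).
  rewrite big1_eq S0 in S.
  have /forallP Vj : [forall j, col j V == 0] by rewrite -S.2.
  have -> : V = 0.
    by apply/matrixP => i j; have /eqP/matrixP/(_ i 0) := Vj j; rewrite !mxE.
  by rewrite mul0mx; apply/matrixP => i j; rewrite !mxE.
(* The alternative gives d |v|^2 <= c quad M v <= |c| (- quad M v); adding 1 keeps the denominator
   positive. *)
exists (d / (`|c 0 0| + 1)); split; first by rewrite divr_gt0 // ltr_wpDl.
move=> v; have := H v; rewrite -[f' _]/(f _) /f mul_mx_scalar mxtraceZ.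
rewrite mxtrace_rank1 -/(quad M v) -/(dot v v) /mxtrace big_ord1 mxE => Hv.
have Mv : quad M v <= 0.
  by have [->|/M0/ltW//] := eqVneq v 0; rewrite quad_dot dot0l.
rewrite mulrAC -lerN2 opprK ler_pdivrMr ?ltr_wpDl //.
apply: le_trans Hv _; apply: le_trans (ler_norm _) _.
rewrite normrM (ler0_norm Mv) ler_wpM2l ?oppr_ge0 // lerDl ler01 //.
Qed.
End Dot.

(** * H-infinity bounds as linear matrix inequalities *)

Section BoundedReal.
Variable R : realType.
Local Notation C := R[i].

Lemma resolvent_unit k (A : 'M[R]_k) (s : C) : hurwitz A -> 0 <= complex.Re s ->
  s%:M - cmx A \in unitmx.
Proof.
move=> hA s0; rewrite unitmxE unitfE; apply/negP => /det0P[v v0 /eqP].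
rewrite mulmxBr subr_eq0 mul_mx_scalar => /eqP Av.
have /hA : eigenvalue (cmx A) s by apply/eigenvalueP; exists v.
by rewrite ltNge s0.
Qed.

Lemma Rem_scale a b s (V : 'M[C]_(a, b)) :
  Rem (s *: V) = complex.Re s *: Rem V - complex.Im s *: Imm V.
Proof. by apply/matrixP => i j; rewrite !mxE; case: s; case: (V i j). Qed.

Lemma Imm_scale a b s (V : 'M[C]_(a, b)) :
  Imm (s *: V) = complex.Re s *: Imm V + complex.Im s *: Rem V.
Proof. by apply/matrixP => i j; rewrite !mxE; case: s; case: (V i j). Qed.

Section Realization.
Variables (m p q : nat) (A : 'M[R]_m) (B : 'M[R]_(m, p)) (K : 'M[R]_(q, m)).

(** The scaling by g^-1 and g matches the Schur complement of the block - g I in Phi. *)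
Definition brl_weight (g : R) : 'M[R]_(m + p) :=
  block_mx (g^-1 *: (K^T *m K)) 0 0 (- g%:M).

Lemma quad_brl_weight g v : quad (brl_weight g) v =
  g^-1 * dot (K *m usubmx v) (K *m usubmx v) - g * dot (dsubmx v) (dsubmx v).
Proof.
rewrite quad_dot -{1 2}[v]vsubmxK mul_block_col !mul0mx addr0 add0r dot_col_mx.
by rewrite -scalemxAl dotZr dot_mull mulmxA mulNmx mul_scalar_mx dotNr dotZr.
Qed.

Lemma hquad_brl_weight g v : hquad (brl_weight g) v =
  g^-1 * hnorm (cmx K *m usubmx v) - g * hnorm (dsubmx v).
Proof.
have Ru : usubmx (Rem v) = Rem (usubmx v) by apply/matrixP => i j; rewrite !mxE.
have Iu : usubmx (Imm v) = Imm (usubmx v) by apply/matrixP => i j; rewrite !mxE.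
have Rd : dsubmx (Rem v) = Rem (dsubmx v) by apply/matrixP => i j; rewrite !mxE.
have Id : dsubmx (Imm v) = Imm (dsubmx v) by apply/matrixP => i j; rewrite !mxE.
rewrite /hquad !quad_brl_weight /hnorm Rem_cmxl Imm_cmxl Ru Iu Rd Id; ring.
Qed.

Lemma Hinf_norm_lt g : 0 < g -> (Hinf_norm A B K < g%:E)%E ->
  hurwitz A /\ forall (w : R) (u : 'cV[C]_p), u != 0 ->
    hnorm (tfun A B K ((w%:C)%C * 'i%C) *m u) < g ^+ 2 * hnorm u.
Proof.
move=> g0; rewrite /Hinf_norm; case: asboolP => // hA H; split=> // w u u0.
set G := tfun _ _ _ _.
have sg : sigma_max G < g.
  rewrite -lte_fin; apply: le_lt_trans H; apply: ereal_sup_ubound.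
  by exists w.
have cu : 0 < cvnorm u by rewrite cvnormE sqrtr_gt0 hnorm_gt0.
have : cvnorm (G *m u) < g * cvnorm u.
  by apply: le_lt_trans (cvnorm_le_sigma_max G u) _; rewrite ltr_pM2r.
rewrite !cvnormE => h.
rewrite -[hnorm (G *m u)]sqr_sqrtr ?hnorm_ge0 // -[hnorm u]sqr_sqrtr ?hnorm_ge0 //.
by rewrite -exprMn ltr_pXn2r ?nnegrE ?mulr_ge0 ?sqrtr_ge0 // ltW.
Qed.

(** This is [kyp] for [brl_weight]: at zero state the form is - g |u|^2, and otherwise x = (i w -
    A)^-1 B u, so K x is the transfer function applied to u. Setting u = 0 in the result gives the
    Lyapunov inequality, hence X > 0. *)
Lemma bounded_real_lmi g : 0 < g -> (Hinf_norm A B K < g%:E)%E ->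
  exists X d, [/\ posdef X, 0 < d & forall x u,
    dot (X *m x) (A *m x + B *m u) *+ 2 + g^-1 * dot (K *m x) (K *m x) - g * dot u u
      <= - (d * (dot x x + dot u u))].
Proof.
move=> g0 /(Hinf_norm_lt g0)[hA hG].
have [|X [d [sX d0 H]]] := @kyp R m p A B (brl_weight g).
  move=> w v v0 Hv; rewrite hquad_brl_weight subr_lt0.
  have vE : v = col_mx (usubmx v) (dsubmx v) by rewrite vsubmxK.
  case: Hv => [x0|].
    have u0 : dsubmx v != 0.
      by apply: contra v0 => /eqP u0; rewrite vE x0 u0 col_mx0.
    rewrite x0 mulmx0 hnorm_hquad hquad0 mulr0 mulr_gt0 //; exact: hnorm_gt0.
  rewrite {1}vE /cmx map_row_mx mul_row_col -/(cmx A) -/(cmx B).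
  set x := usubmx v; set u := dsubmx v => Hx; set s := _ * _ in Hx.
  have us : s%:M - cmx A \in unitmx.
    by apply: resolvent_unit => //; rewrite /s /= !mul0r mul1r subr0.
  have xE : x = invmx (s%:M - cmx A) *m (cmx B *m u).
    apply: (canRL (mulKmx us)).
    by rewrite mulmxBl mul_scalar_mx -Hx addrC addKr.
  have u0 : u != 0.
    apply: contra v0 => /eqP u0.
    by rewrite vE -/x -/u xE u0 !mulmx0 col_mx0.
  have := hG w u u0; have -> : (w%:C)%C * 'i%C = s by rewrite mulrC.
  by rewrite ltr_pdivrMl // mulrA -expr2 xE /tfun !mulmxA.
have HX x u : dot (X *m x) (A *m x + B *m u) *+ 2 + g^-1 * dot (K *m x) (K *m x)
    - g * dot u u <= - (d * (dot x x + dot u u)).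
  have := H (col_mx x u); rewrite quad_brl_weight !col_mxKu !col_mxKd mul_row_col.
  rewrite -[(_^T *m col_mx x u) 0 0]/(dot _ _) dot_col_mx addrA.
  by rewrite -{1}sX -trmx_mul.
exists X, d; split=> //; apply: (lyapunov_posdef hA sX) => x x0.
have := HX x 0; rewrite mulmx0 addr0 dot0r mulr0 subr0 addr0.
have -> : quad (X *m A) x = dot (X *m x) (A *m x).
  by rewrite quad_dot dot_mull sX mulmxA.
have := mulr_gt0 d0 (dot_gt0 x0).
have : 0 <= g^-1 * dot (K *m x) (K *m x) by rewrite mulr_ge0 ?dot_ge0 // invr_ge0 ltW.
lra.
Qed.

(** With u = 0 the inequality excludes eigenvalues of nonnegative real part. Summed over the real
    and imaginary parts of x = (i w - A)^-1 B u, it loses its derivative term and bounds the gain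
    uniformly below g. *)
Lemma lmi_bounded_real g t e X : 0 < g -> 0 < t -> 0 < e -> posdef X ->
  (forall x u, dot (X *m x) (A *m x + B *m u) *+ 2
      + t * (g^-1 * dot (K *m x) (K *m x) - g * dot u u)
      <= - (e * (dot x x + dot u u))) ->
  (Hinf_norm A B K < g%:E)%E.
Proof.
move=> g0 t0 e0 [sX pX] H.
have XC a b : dot (X *m a) b = dot (X *m b) a by rewrite dot_mull sX dotC.
have hA : hurwitz A.
  move=> s es; rewrite ltNge; apply/negP => s0.
  (* [eigenvalue] provides a left eigenvector, while the form needs a right one; invertibility of s
     - A links the two. *)
  have : s%:M - cmx A \in unitmx.
    apply: unitmx_ker0 => v Av; apply/eqP; apply: contraT => v0.
    have {}Av : cmx A *m v = s *: v.
      by apply/esym/eqP; rewrite -subr_eq0 -mul_scalar_mx -mulmxBl Av.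
    have XAlt x : x != 0 -> dot (X *m x) (A *m x) < 0.
      move=> x0; have := H x 0; rewrite mulmx0 addr0 dot0r mulr0 subr0 addr0.
      have := mulr_gt0 e0 (dot_gt0 x0).
      have : 0 <= t * (g^-1 * dot (K *m x) (K *m x)).
        by rewrite !mulr_ge0 ?dot_ge0 ?invr_ge0 // ltW.
      lra.
    have qE x : quad (X *m A) x = dot (X *m x) (A *m x).
      by rewrite quad_dot dot_mull sX mulmxA.
    have : hquad (X *m A) v < 0.
      by apply: hquad_lt0 => // x /XAlt; rewrite qE.
    rewrite /hquad !qE -[A *m Rem v]Rem_cmxl -[A *m Imm v]Imm_cmxl Av Rem_scale Imm_scale.
    rewrite !(dotDr, dotNr, dotZr) [dot (X *m Imm v) (Rem v)]XC.
    have Xge0 x : 0 <= dot (X *m x) x.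
      have [->|/pX/ltW] := eqVneq x 0; first by rewrite dot0r.
      by rewrite -/(quad X x) quad_dot dotC.
    have := mulr_ge0 s0 (Xge0 (Rem v)); have := mulr_ge0 s0 (Xge0 (Imm v)).
    lra.
  move: es => /eigenvalueP[v Av v0].
  move=> us; case/eqP: v0; rewrite -[v]mulmx1 -(mulmxV us) mulmxA mulmxBr Av.
  by rewrite mul_mx_scalar subrr mul0mx.
rewrite /Hinf_norm asboolT //.
(* c bounds the squared gain, with the margin e making it less than g^2. If c is negative,
   [Num.sqrt c] is 0 and the estimates still hold. *)
pose c := g ^+ 2 - e * g / t.
apply: (@le_lt_trans _ _ (Num.sqrt c)%:E); last first.
  rewrite lte_fin -[ltRHS]ger0_norm ?ltW // -sqrtr_sqr ltr_sqrt ?exprn_gt0 //.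
  by rewrite /c gtrBl divr_gt0 // mulr_gt0.
apply: ge_ereal_sup => _ [w _ <-]; rewrite lee_fin.
apply: sigma_max_le; first exact: sqrtr_ge0.
move=> u; have -> : Num.sqrt c * cvnorm u = Num.sqrt (hnorm u * c).
  by rewrite cvnormE sqrtrM ?hnorm_ge0 // mulrC.
rewrite cvnormE; apply: ler_wsqrtr.
set s := _ * _.
have us : s%:M - cmx A \in unitmx.
  by apply: resolvent_unit => //; rewrite /s /= mulr0 mul0r subr0.
pose x := invmx (s%:M - cmx A) *m (cmx B *m u).
have Hx : cmx A *m x + cmx B *m u = s *: x.
  have : (s%:M - cmx A) *m x = cmx B *m u by rewrite /x mulKVmx.
  by rewrite mulmxBl mul_scalar_mx => <-; rewrite addrC subrK.
have GuE : tfun A B K s *m u = cmx K *m x by rewrite /tfun /x !mulmxA.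
have := H (Rem x) (Rem u); have := H (Imm x) (Imm u).
rewrite -![A *m Rem _]Rem_cmxl -![A *m Imm _]Imm_cmxl.
rewrite -![B *m Rem _]Rem_cmxl -![B *m Imm _]Imm_cmxl.
rewrite -![K *m Rem _]Rem_cmxl -![K *m Imm _]Imm_cmxl.
have RD (M N : 'cV[C]_m) : Rem M + Rem N = Rem (M + N).
  by apply/matrixP => i j; rewrite !mxE raddfD.
have ID (M N : 'cV[C]_m) : Imm M + Imm N = Imm (M + N).
  by apply/matrixP => i j; rewrite !mxE raddfD.
rewrite RD ID Hx Rem_scale Imm_scale.
have -> : complex.Re s = 0 by rewrite /s /= mulr0 mul0r subrr.
have -> : complex.Im s = w by rewrite /s /= mulr1 mul0r addr0.
(* For s = i w the two derivative terms are - w x_r^T X x_i and w x_i^T X x_r, which cancel by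
   symmetry of X. *)
rewrite !scale0r sub0r add0r dotNr !dotZr [dot (X *m Imm x) _]XC.
rewrite GuE /hnorm.
have := dot_ge0 (Rem x); have := dot_ge0 (Imm x).
move: (dot (Rem x) _) (dot (Imm x) _) => xr xi xi0 xr0.
move: (dot (Rem u) _) (dot (Imm u) _) => ur ui.
move: (dot (Rem (cmx K *m x)) _) (dot (Imm (cmx K *m x)) _) => kr ki.
move: (w * _) => z hi hr.
have h : t * (g^-1 * (kr + ki) - g * (ur + ui)) <= - (e * (ur + ui)).
  have := mulr_ge0 (ltW e0) xi0; have := mulr_ge0 (ltW e0) xr0; lra.
have : g / t * (t * (g^-1 * (kr + ki) - g * (ur + ui))) <= g / t * - (e * (ur + ui)).
  by rewrite ler_pM2l // divr_gt0.
have -> : g / t * (t * (g^-1 * (kr + ki) - g * (ur + ui))) = kr + ki - g ^+ 2 * (ur + ui).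
  by field; rewrite !gt_eqF.
have -> : g / t * - (e * (ur + ui)) = (ur + ui) * (c - g ^+ 2).
  by rewrite /c; field; rewrite !gt_eqF.
lra.
Qed.
End Realization.
End BoundedReal.

(** * Elimination of the last two blocks *)

Section Reduction.
Variable R : realType.

Lemma quad_blk4 a b c d
  (M11 : 'M[R]_(a, a)) (M12 : 'M[R]_(a, b)) (M13 : 'M[R]_(a, c)) (M14 : 'M[R]_(a, d))
  (M21 : 'M[R]_(b, a)) (M22 : 'M[R]_(b, b)) (M23 : 'M[R]_(b, c)) (M24 : 'M[R]_(b, d))
  (M31 : 'M[R]_(c, a)) (M32 : 'M[R]_(c, b)) (M33 : 'M[R]_(c, c)) (M34 : 'M[R]_(c, d))
  (M41 : 'M[R]_(d, a)) (M42 : 'M[R]_(d, b)) (M43 : 'M[R]_(d, c)) (M44 : 'M[R]_(d, d))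
  x u y z :
  quad (blk4 M11 M12 M13 M14 M21 M22 M23 M24 M31 M32 M33 M34 M41 M42 M43 M44)
    (col_mx (col_mx x u) (col_mx y z)) =
  (dot x (M11 *m x) + dot x (M12 *m u) + dot x (M13 *m y) + dot x (M14 *m z))
  + (dot u (M21 *m x) + dot u (M22 *m u) + dot u (M23 *m y) + dot u (M24 *m z))
  + (dot y (M31 *m x) + dot y (M32 *m u) + dot y (M33 *m y) + dot y (M34 *m z))
  + (dot z (M41 *m x) + dot z (M42 *m u) + dot z (M43 *m y) + dot z (M44 *m z)).
Proof.
rewrite quad_dot /blk4 !mul_block_col !add_col_mx !dot_col_mx !dotDr; ring.
Qed.

Variables (n r p q mE mEh : nat).
Variables (E : 'M[R]_n) (D : 'M[R]_(n, mE)) (W : 'M[R]_mE)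
          (F : 'M[R]_(n, p)) (H : 'M[R]_(q, n)) (Pi : 'M[R]_(n, r))
          (Dh : 'M[R]_(r, mEh)) (Wh : 'M[R]_mEh) (Eh : 'M[R]_r).
Local Notation m := (n.-1 + r.-1)%N.
Local Notation A := (Ae E D W Dh Wh Eh).
Local Notation B := (Be E F Pi Eh).
Local Notation K := (Ce E H Pi Eh).
Local Notation Ar := (Aer n Dh Wh Eh).
Local Notation Br := (Ber E F Pi Eh).
Local Notation J := (Jmat R n r).
Local Notation Phi := (Phi_inf E D W F H Pi Dh Wh Eh).

Lemma Phi_inf_sym X t g : X^T = X -> (Phi X t g)^T = Phi X t g.
Proof.
move=> sX; rewrite /Phi_inf /psi_inf /phi_inf /blk4.
move: (Aen r E D W) (Ben r E F) (Cen r E H) (Cer H Pi Eh) Ar Br J.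
move=> An Bn Cn Cr Ar Br J.
have tD a b (M N : 'M[R]_(a, b)) : (M + N)^T = M^T + N^T by rewrite linearD.
have tN a b (M : 'M[R]_(a, b)) : (- M)^T = - M^T by rewrite linearN.
have tZ a b k (M : 'M[R]_(a, b)) : (k *: M)^T = k *: M^T by rewrite linearZ.
rewrite !tD !tr_block_mx !(tD, tN, tZ, trmx_mul, trmxK, trmx0, trmx1) sX.
by rewrite [X *m An + _]addrC.
Qed.

(** The terms in z and - |w|^2 make - |z - (w + j)|^2 + 2 w.j + |j|^2. The cross term 2 w.j supplies
    the part J (Ar x + Br u) of the dynamics, and |j|^2 is the perturbation. *)
Lemma quad_Phi_inf X t g x u y z : X^T = X ->
  let w := Ar *m x + Br *m u in let j := J^T *m (X *m x) in
  quad (Phi X t g) (col_mx (col_mx x u) (col_mx y z)) =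
  dot (X *m x) (A *m x + B *m u) *+ 2 + dot j j + (t * dot y (K *m x)) *+ 2
  - t * g * (dot u u + dot y y) - dot (z - (w + j)) (z - (w + j)).
Proof.
move=> sX /=; rewrite /Phi_inf quadD /psi_inf /phi_inf !quad_blk4 /Ae /Be /Ce.
move: (Aen r E D W) (Ben r E F) (Cen r E H) (Cer H Pi Eh) Ar Br J.
move=> An Bn Cn Cr Ar Br J.
have trr k l (M : 'M[R]_(k, l)) a b : dot a (M^T *m b) = dot (M *m a) b.
  by rewrite dot_mull.
have [h hE] : exists h, h = X *m x by eexists.
have [j jE] : exists j, j = J^T *m h by eexists.
have Xr b : dot x (X *m b) = dot h b by rewrite hE dot_mull sX.
have Jr b : dot h (J *m b) = dot j b by rewrite jE dot_mull trmxK.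
rewrite !(mul0mx, mulNmx, mulmxDl) -!scalemxAl !mul1mx -!mulmxA -hE -jE.
rewrite !(dot0r, dotNr, dotDr, dotDl, dotNl, dotZr, Xr, Jr, trr).
rewrite [dot (An *m x) h]dotC [dot (Bn *m u) h]dotC [dot (Cn *m x) y]dotC.
rewrite [dot (Cr *m x) y]dotC [dot z (Ar *m x)]dotC [dot z (Br *m u)]dotC.
rewrite [dot z j]dotC [dot (Br *m u) (Ar *m x)]dotC [dot (Ar *m x) j]dotC.
rewrite [dot (Br *m u) j]dotC; ring.
Qed.

Lemma Phi_inf_lt0_bounded_real X t g : 0 < g -> 0 < t -> posdef X ->
  negdef (Phi X t g) -> (Hinf_norm A B K < g%:E)%E.
Proof.
move=> g0 t0 pX [_ nP]; have [e [e0 He]] := negdef_bound nP.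
apply: (@lmi_bounded_real R _ _ _ A B K g t e X g0 t0 e0 pX) => x u.
(* Take the maximizers of the form: this z kills the square, and y = g^-1 K x turns the terms in y
   into t g^-1 |K x|^2. The nonnegative |j|^2 can then be dropped. *)
set z := (Ar *m x + Br *m u) + J^T *m (X *m x).
have := He (col_mx (col_mx x u) (col_mx (g^-1 *: (K *m x)) z)).
rewrite quad_Phi_inf ?pX.1 //= -/z subrr dot0r !dot_col_mx !dotZr !dotZl.
have := dot_ge0 (J^T *m (X *m x)); have := mulr_ge0 (ltW e0) (dot_ge0 z).
have := mulr_ge0 (ltW e0) (dot_ge0 (g^-1 *: (K *m x))); rewrite !dotZr !dotZl.
move: (dot (K *m x) _) (dot z z) (dot (J^T *m _) _) (dot x x) (dot u u) (dot (X *m x) _).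
move=> k zz jj xx uu h H1 H2 H3.
have -> : t * g * (uu + g^-1 * (g^-1 * k)) = t * g * uu + t * (g^-1 * k).
  by field; rewrite gt_eqF.
lra.
Qed.

Lemma bounded_real_Phi_inf_lt0 g : 0 < g -> (Hinf_norm A B K < g%:E)%E ->
  exists X t, [/\ posdef X, 0 < t & negdef (Phi X t g)].
Proof.
move=> g0 /(bounded_real_lmi g0)[X [d [pX d0 HX]]].
have [k [k0 Hk]] := dot_mulmx_bound (J^T *m X).
(* For t X the decrease d |x|^2 scales by t but |j|^2 <= k |x|^2 scales by t^2; this choice gives t
   k = d - t < d. *)
pose t := d / (k + 1); have t0 : 0 < t by rewrite divr_gt0 // ltr_wpDl.
have sX := pX.1.
have sX' : (t *: X)^T = t *: X by rewrite linearZ /= sX.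
exists (t *: X), t; split=> //.
  split=> // v /pX.2 v0; by rewrite -scalemxAr -scalemxAl mx11_scale mulr_gt0.
split; first exact: Phi_inf_sym.
move=> v v0; rewrite -/(quad _ v).
have [x [u [y [z vE]]]] : exists x u y z, v = col_mx (col_mx x u) (col_mx y z).
  exists (usubmx (usubmx v)), (dsubmx (usubmx v)).
  exists (usubmx (dsubmx v)), (dsubmx (dsubmx v)).
  by rewrite !vsubmxK.
rewrite {}vE quad_Phi_inf //= in v0 *.
have := HX x u; have := Hk x; rewrite -mulmxA.
set j := J^T *m (X *m x).
have -> : J^T *m (t *: X *m x) = t *: j by rewrite -scalemxAl -scalemxAr.
(* s completes the square in y, as w does in z. *)
set w := z - _; pose s := y - g^-1 *: (K *m x).
have sE : g * dot s s = g * dot y y - dot y (K *m x) *+ 2 + g^-1 * dot (K *m x) (K *m x).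
  rewrite /s !(dotDl, dotDr, dotNl, dotNr, dotZl, dotZr) [dot (K *m x) y]dotC.
  by field; rewrite gt_eqF.
rewrite -scalemxAl !dotZl dotZr.
have tk : t * k = d - t by rewrite /t; field; rewrite gt_eqF // ltr_wpDl.
(* This quantity bounds minus the form from below. It is positive because x = 0 gives s = y, and x,
   u, y all zero give w = z. *)
have pos : 0 < t * (t * dot x x + d * dot u u + g * dot s s) + dot w w.
  have P k' (a : 'cV[R]_k') c : 0 < c -> 0 <= c * dot a a.
    by move=> c0; rewrite mulr_ge0 ?dot_ge0 // ltW.
  have x_ge := P _ x t t0; have u_ge := P _ u d d0; have s_ge := P _ s g g0.
  have w_ge := dot_ge0 w.
  have L a : 0 < a -> 0 < t * a + dot w w by move=> a0; rewrite ltr_pwDl // mulr_gt0.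
  have [x0|x0] := eqVneq x 0; last first.
    by apply: L; have := mulr_gt0 t0 (dot_gt0 x0); lra.
  have [u0|u0] := eqVneq u 0; last first.
    by apply: L; have := mulr_gt0 d0 (dot_gt0 u0); lra.
  have [y0|y0] := eqVneq y 0; last first.
    have ys : s = y by rewrite /s x0 mulmx0 scaler0 subr0.
    by apply: L; have := mulr_gt0 g0 (dot_gt0 y0); rewrite ys in s_ge *; lra.
  apply: ltr_wpDl; first by rewrite mulr_ge0 ?(ltW t0) // !addr_ge0.
  apply: dot_gt0; rewrite /w /j x0 u0 !mulmx0 scaler0 !addr0 subr0.
  by apply: contra v0 => /eqP ->; rewrite x0 u0 y0 !col_mx0.
move: sE pos; move: (dot s s) (dot w w) => ss ww sE pos hk hx.
have {}hk := ler_wpM2l (ltW t0) hk; rewrite mulrA tk in hk.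
have := ler_wpM2l (ltW t0) hx; have := ler_wpM2l (ltW t0) hk.
move: pos; rewrite sE.
lra.
Qed.

End Reduction.

Theorem theorem1 (R : realType) (n r p q mE mEh : nat)
  (E : 'M[R]_n) (D : 'M[R]_(n, mE)) (W : 'M[R]_mE)
  (F : 'M[R]_(n, p)) (H : 'M[R]_(q, n)) (Pi : 'M[R]_(n, r))
  (Dh : 'M[R]_(r, mEh)) (gamma : R) :
  is_incidence D -> simple_incidence D -> connected_incidence D ->
  posdiag W -> posdiag E ->
  clustering Pi -> reduced_incidence Pi D Dh ->
  0 < gamma ->
  (exists (Wh : 'M[R]_mEh) (Eh : 'M[R]_r),
      posdiag Wh /\ posdiag Eh /\
      (Hinf_norm (Ae E D W Dh Wh Eh) (Be E F Pi Eh) (Ce E H Pi Eh)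
         < gamma%:E)%E)
  <->
  (exists (Xh : 'M[R]_(n.-1 + r.-1)) (Wh : 'M[R]_mEh) (Eh : 'M[R]_r)
          (thetah : R),
      posdef Xh /\ posdiag Wh /\ posdiag Eh /\ 0 < thetah /\
      negdef (Phi_inf E D W F H Pi Dh Wh Eh Xh thetah gamma)).
Proof.
move=> _ _ _ _ _ _ _ g0; split.
  move=> [Wh [Eh [pW [pE lt]]]].
  have [X [t [pX t0 nP]]] := bounded_real_Phi_inf_lt0 g0 lt.
  by exists X, Wh, Eh, t.
move=> [X [Wh [Eh [t [pX [pW [pE [t0 nP]]]]]]]].
by exists Wh, Eh; split; [|split; [|exact: Phi_inf_lt0_bounded_real nP]].
Qed.
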